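(* Let $\Gamma=(V,E,s,t)$ be a multiquiver, $\mathcal{A}(\Gamma)$ the corresponding TGW algebra, and $\mathfrak{g}$ the Kac–Moody algebra associated to the Dynkin diagram $D(\Gamma)$, i.e. to the generalized Cartan matrix $(a_{ij})_{i,j\in V}$ with $a_{ii}=2$ and $a_{ij}=-\sum_{e\in E,\ \gamma_{ei}\neq0}|\gamma_{ej}|$ for $i\ne j$. Let $\mathfrak{n}^+$ (respectively $\mathfrak{n}^-$) be the positive (respectively negative) subalgebra of $\mathfrak{g}$ with generators $e_i$ (respectively $f_i$), $i\in V$. Then there exist graded $\Bbbk$-algebra homomorphisms $$\psi^+:U(\mathfrak{n}^+)\to\mathcal{A}(\Gamma),\ e_i\mapsto X_i,\qquad \psi^-:U(\mathfrak{n}^-)\to\mathcal{A}(\Gamma),\ f_i\mapsto Y_i.$$ Moreover, for any $i,j\in V$, $i\neq j$, and any integer $k$ with $0\le k\le -a_{ij}$, the restrictions $$\psi^+|_{U(\mathfrak{n}^+)_{k\alpha_i+\alpha_j}}\quad\text{and}\quad\psi^-|_{U(\mathfrak{n}^-)_{-k\alpha_i-\alpha_j}}$$ are injective, where $\{\alpha_i\}_{i\in V}$ is the set of simple roots of $\mathfrak{g}$.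
   Context: $\Bbbk$ is an algebraically closed field of characteristic zero; rings are associative and unital; $\mathbb{Z}X$ denotes the free abelian group on a set $X$. TGW algebras. A TGW datum $(R,\sigma,t)$ with index set $I$: a $\Bbbk$-algebra $R$, commuting $\Bbbk$-algebra automorphisms $\sigma=(\sigma_i)_{i\in I}$ of $R$, nonzero central elements $t=(t_i)_{i\in I}$ of $R$. Given $\mu=(\mu_{ij})_{i\ne j}$ with $\mu_{ij}\in\Bbbk\setminus\{0\}$, $\mathcal{C}_\mu(R,\sigma,t)$ is the free $R$-ring on symbols $X_i,Y_i$ ($i\in I$) modulo the relations $X_ir=\sigma_i(r)X_i$, $Y_ir=\sigma_i^{-1}(r)Y_i$, $Y_iX_i=t_i$, $X_iY_i=\sigma_i(t_i)$ ($r\in R$, $i\in I$), $X_iY_j=\mu_{ij}Y_jX_i$ ($i\neq j$). It is $\mathbb{Z}I$-graded by $\deg X_i=i$, $\deg Y_i=-i$, $\deg r=0$. The TGW algebra $\mathcal{A}_\mu(R,\sigma,t)$ is the quotient of $\mathcal{C}_\mu(R,\sigma,t)$ by the sum of all graded ideals having zero intersection with the degree-zero component; it is $\mathbb{Z}I$-graded. Multiquivers. A multiquiver $\Gamma=(V,E,s,t)$ consists of sets $V$, $E$ and functions $s,t:E\to (V\times\mathbb{Z}_{>0})\cup\{\emptyset\}$ such that (no loops) if $s(e)=(u,m)$ and $t(e)=(v,n)$ then $u\ne v$; and (local finiteness) for each $v\in V$ only finitely many $e$ have $s(e)\in\{v\}\times\mathbb{Z}_{>0}$ or $t(e)\in\{v\}\times\mathbb{Z}_{>0}$.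 The incidence matrix is $\gamma_{ev}=n$ if $t(e)=(v,n)$, $\gamma_{ev}=-n$ if $s(e)=(v,n)$, and $\gamma_{ev}=0$ otherwise. $\mathcal{A}(\Gamma)$ is the TGW algebra $\mathcal{A}_\mu(R_E,\sigma^\Gamma,t^\Gamma)$ with index set $V$, where all $\mu_{ij}=1$, $R_E=\Bbbk[u_e\mid e\in E]$ (polynomial algebra), $\sigma_v(u_e)=u_e-\gamma_{ev}$, $t_v=\prod_{e\in E}u_{ev}$ with $u_{ev}=u_e(u_e+1)\cdots(u_e+\gamma_{ev}-1)$ if $\gamma_{ev}>0$, $u_{ev}=1$ if $\gamma_{ev}=0$, $u_{ev}=(u_e-1)(u_e-2)\cdots(u_e-|\gamma_{ev}|)$ if $\gamma_{ev}<0$. Kac–Moody conventions: $\mathfrak{n}^+$ is the Lie algebra generated by $e_i$ ($i\in V$) subject to the Serre relations $(\operatorname{ad}e_i)^{1-a_{ij}}(e_j)=0$ for $i\neq j$, and $\mathfrak{n}^-$ is defined likewise with $f_i$. $U(\mathfrak{n}^{\pm})$ are graded by the root lattice $\bigoplus_{i\in V}\mathbb{Z}\alpha_i$, identified with $\mathbb{Z}V$ via $\alpha_i\leftrightarrow i$, with $\deg e_i=\alpha_i$, $\deg f_i=-\alpha_i$; $U(\mathfrak{n}^\pm)_\beta$ denotes the degree $\beta$ component. *)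

(* Defs.v *)
From HB Require Import structures.
From mathcomp Require Import all_boot all_order all_algebra.
From mathcomp Require Import generic_quotient finmap.
From mathcomp Require Import boolp classical_sets functions cardinality fsbigop.
From mathcomp Require Import xfinmap monalg.

Set Implicit Arguments.
Unset Strict Implicit.
Unset Printing Implicit Defensive.

Import Order.TTheory GRing.Theory Num.Theory.

Local Open Scope ring_scope.
Local Open Scope quotient_scope.

(* MathComp's algType excludes the zero ring, so it has no instance on a      *)
(* quotient by an arbitrary ideal. A kAlgType is an associative unital        *)
(* k-algebra, possibly zero, presented as a ring A with a ring morphism       *)
(* kcst : k -> A whose image is central.                                      *)
HB.mixin Record isKAlgebra (k : fieldType) A of GRing.PzRing A := {
  kcst : k -> A;
  kcstD : forall c d, kcst (c + d) = kcst c + kcst d;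
  kcstM : forall c d, kcst (c * d) = kcst c * kcst d;
  kcst1 : kcst 1 = 1;
  kcst_central : forall c x, kcst c * x = x * kcst c
}.

#[short(type="kAlgType")]
HB.structure Definition KAlgebra (k : fieldType) :=
  {A of isKAlgebra k A & GRing.PzRing A}.

Section MalgKAlgebra.
Variables (k : fieldType) (M : monomType).

Lemma malgC_central (c : k) (x : {malg k[M]}) : c%:MP * x = x * c%:MP.
Proof.
rewrite !malgM_def fgmulUg fgmulgU; apply: eq_bigr => m _.
by rewrite mul1m mulm1 mulrC.
Qed.

HB.instance Definition _ := isKAlgebra.Build k {malg k[M]}
  (raddfD (@malgC M k)) (rmorphM (@malgC M k)) (rmorph1 (@malgC M k))
  malgC_central.
End MalgKAlgebra.

Section AlgebraQuotient.
Variables (k : fieldType) (A : kAlgType k).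

Definition two_sided_ideal (J : set A) : Prop :=
  [/\ J 0, forall x y, J x -> J y -> J (x + y),
      forall a x, J x -> J (a * x) & forall x a, J x -> J (x * a)].

Inductive ideal_gen (S : set A) : A -> Prop :=
| ideal_gen_in x : S x -> ideal_gen S x
| ideal_gen_0 : ideal_gen S 0
| ideal_gen_add x y : ideal_gen S x -> ideal_gen S y -> ideal_gen S (x + y)
| ideal_gen_mull a x : ideal_gen S x -> ideal_gen S (a * x)
| ideal_gen_mulr x a : ideal_gen S x -> ideal_gen S (x * a).

Variable S : set A.

Lemma ideal_genN x : ideal_gen S x -> ideal_gen S (- x).
Proof. by move=> Sx; rewrite -mulN1r; apply: ideal_gen_mull. Qed.

Definition alg_eqv (x y : A) : bool := `[< ideal_gen S (x - y) >].

Lemma alg_eqv_refl : reflexive alg_eqv.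
Proof. by move=> x; apply/asboolP; rewrite subrr; apply: ideal_gen_0. Qed.

Lemma alg_eqv_sym : symmetric alg_eqv.
Proof.
by move=> x y; apply/asboolP/asboolP => /ideal_genN; rewrite opprB.
Qed.

Lemma alg_eqv_trans : transitive alg_eqv.
Proof.
move=> y x z /asboolP xy /asboolP yz; apply/asboolP.
by rewrite -(subrKA y); apply: ideal_gen_add.
Qed.

Canonical alg_eqv_equiv :=
  EquivRel alg_eqv alg_eqv_refl alg_eqv_sym alg_eqv_trans.

Definition alg_quot : Type := {eq_quot alg_eqv}.

HB.instance Definition _ := Choice.on alg_quot.

Definition alg_pi (x : A) : alg_quot := \pi_({eq_quot alg_eqv}) x.

Lemma alg_piP x y : alg_pi x = alg_pi y <-> ideal_gen S (x - y).
Proof.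
rewrite /alg_pi; split; first by move/eqmodP/asboolP.
by move=> xy; apply/eqmodP/asboolP.
Qed.

Definition alg_repr (x : alg_quot) : A := repr (x : {eq_quot alg_eqv}).

Lemma alg_reprK x : alg_pi (alg_repr x) = x.
Proof. exact: reprK. Qed.

Lemma alg_pi_repr x : ideal_gen S (alg_repr (alg_pi x) - x).
Proof. by apply/alg_piP; rewrite alg_reprK. Qed.

Definition aq_add (x y : alg_quot) := alg_pi (alg_repr x + alg_repr y).
Definition aq_opp (x : alg_quot) := alg_pi (- alg_repr x).
Definition aq_mul (x y : alg_quot) := alg_pi (alg_repr x * alg_repr y).

Lemma aq_addE x y : aq_add (alg_pi x) (alg_pi y) = alg_pi (x + y).
Proof.
apply/alg_piP; rewrite opprD addrACA.
by apply: ideal_gen_add; apply: alg_pi_repr.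
Qed.

Lemma aq_oppE x : aq_opp (alg_pi x) = alg_pi (- x).
Proof. by apply/alg_piP; rewrite -opprD; apply/ideal_genN/alg_pi_repr. Qed.

Lemma aq_mulE x y : aq_mul (alg_pi x) (alg_pi y) = alg_pi (x * y).
Proof.
apply/alg_piP; set x' := alg_repr _; set y' := alg_repr _.
have -> : x' * y' - x * y = (x' - x) * y' + x * (y' - y).
  by rewrite mulrBl mulrBr subrKA.
apply: ideal_gen_add; first by apply/ideal_gen_mulr/alg_pi_repr.
exact/ideal_gen_mull/alg_pi_repr.
Qed.

Lemma alg_quotW (P : alg_quot -> Prop) :
  (forall x, P (alg_pi x)) -> forall x, P x.
Proof. by move=> Ppi x; rewrite -(alg_reprK x). Qed.

Lemma aq_addA : associative aq_add.
Proof.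
elim/alg_quotW => x; elim/alg_quotW => y; elim/alg_quotW => z.
by rewrite !aq_addE addrA.
Qed.

Lemma aq_addC : commutative aq_add.
Proof.
by elim/alg_quotW => x; elim/alg_quotW => y; rewrite !aq_addE addrC.
Qed.

Lemma aq_add0 : left_id (alg_pi 0) aq_add.
Proof. by elim/alg_quotW => x; rewrite aq_addE add0r. Qed.

Lemma aq_addN : left_inverse (alg_pi 0) aq_opp aq_add.
Proof. by elim/alg_quotW => x; rewrite aq_oppE aq_addE addNr. Qed.

HB.instance Definition _ := GRing.isZmodule.Build alg_quot
  aq_addA aq_addC aq_add0 aq_addN.

Lemma aq_mulA : associative aq_mul.
Proof.
elim/alg_quotW => x; elim/alg_quotW => y; elim/alg_quotW => z.
by rewrite !aq_mulE mulrA.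
Qed.

Lemma aq_mul1l : left_id (alg_pi 1) aq_mul.
Proof. by elim/alg_quotW => x; rewrite aq_mulE mul1r. Qed.

Lemma aq_mul1r : right_id (alg_pi 1) aq_mul.
Proof. by elim/alg_quotW => x; rewrite aq_mulE mulr1. Qed.

Lemma aq_mulDl : left_distributive aq_mul +%R.
Proof.
elim/alg_quotW => x; elim/alg_quotW => y; elim/alg_quotW => z.
by rewrite /GRing.add /= !(aq_addE, aq_mulE) mulrDl.
Qed.

Lemma aq_mulDr : right_distributive aq_mul +%R.
Proof.
elim/alg_quotW => x; elim/alg_quotW => y; elim/alg_quotW => z.
by rewrite /GRing.add /= !(aq_addE, aq_mulE) mulrDr.
Qed.

HB.instance Definition _ := GRing.Zmodule_isPzRing.Build alg_quot
  aq_mulA aq_mul1l aq_mul1r aq_mulDl aq_mulDr.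

Definition aq_cst (c : k) : alg_quot := alg_pi (kcst c).

Lemma aq_cstD c d : aq_cst (c + d) = aq_cst c + aq_cst d.
Proof. by rewrite /aq_cst kcstD [RHS]aq_addE. Qed.

Lemma aq_cstM c d : aq_cst (c * d) = aq_cst c * aq_cst d.
Proof. by rewrite /aq_cst kcstM [RHS]aq_mulE. Qed.

Lemma aq_cst1 : aq_cst 1 = 1.
Proof. by rewrite /aq_cst kcst1. Qed.

Lemma aq_cst_central c x : aq_cst c * x = x * aq_cst c.
Proof.
elim/alg_quotW: x => x.
by rewrite [LHS]aq_mulE [RHS]aq_mulE kcst_central.
Qed.

HB.instance Definition _ := isKAlgebra.Build k alg_quot
  aq_cstD aq_cstM aq_cst1 aq_cst_central.

End AlgebraQuotient.

Arguments alg_pi {k A} S x.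

(* The grading of an algebra by prescribed degrees of generators: the         *)
(* smallest family of subspaces (A_d) with 1 in A_0, A_d A_e <= A_(d + e) and *)
(* g j in A_(wt j).                                                           *)
Section Grading.
Variables (k : fieldType) (A : kAlgType k) (G : zmodType) (J : Type).
Variables (g : J -> A) (wt : J -> G).

Inductive graded_by : G -> A -> Prop :=
| graded_by_gen j : graded_by (wt j) (g j)
| graded_by_one : graded_by 0 1
| graded_by_mul d e x y :
    graded_by d x -> graded_by e y -> graded_by (d + e) (x * y)
| graded_by_zero d : graded_by d 0
| graded_by_add d x y : graded_by d x -> graded_by d y -> graded_by d (x + y)
| graded_by_scale d (c : k) x : graded_by d x -> graded_by d (kcst c * x).

Definition component (d : G) : set A := graded_by d.
End Grading.

Definition graded_ideal (k : fieldType) (A : kAlgType k) (G : zmodType)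
    (comp : G -> set A) (J : set A) : Prop :=
  two_sided_ideal J /\
  forall x, J x -> exists2 s : seq A, x = \sum_(y <- s) y
    & forall y, y \in s -> J y /\ exists d, comp d y.

Section FreeRring.
Variables (k : fieldType) (R : algType k) (X : choiceType).

Definition fr_const (r : R) : {malg k[{fmonom (R + X)%type}]} :=
  << fmu (inl r) >>.
Definition fr_var (x : X) : {malg k[{fmonom (R + X)%type}]} :=
  << fmu (inr x) >>.

(* Modulo these relations fr_const becomes a k-algebra morphism.              *)
Inductive freeRring_rel : {malg k[{fmonom (R + X)%type}]} -> Prop :=
| freeRring_add r s :
    freeRring_rel (fr_const (r + s) - (fr_const r + fr_const s))
| freeRring_scale (c : k) r :
    freeRring_rel (fr_const (c *: r) - c *: fr_const r)
| freeRring_mul r s : freeRring_rel (fr_const (r * s) - fr_const r * fr_const s)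
| freeRring_one : freeRring_rel (fr_const 1 - 1).

(* The free R-ring on X in the category of k-algebras.                        *)
Definition freeRring : kAlgType k := alg_quot freeRring_rel.

Definition freeRring_const (r : R) : freeRring := alg_pi _ (fr_const r).
Definition freeRring_var (x : X) : freeRring := alg_pi _ (fr_var x).
End FreeRring.

Arguments freeRring_const {k R} X r.
Arguments freeRring_var {k} R {X} x.

Record tgw_datum (k : fieldType) (I : Type) := TGWDatum {
  tgw_R : algType k;
  tgw_sigma : I -> {lrmorphism tgw_R -> tgw_R};
  tgw_sigmaV : I -> tgw_R -> tgw_R;
  tgw_t : I -> tgw_R;
  tgw_sigmaK : forall i, cancel (tgw_sigma i) (tgw_sigmaV i);
  tgw_sigmaVK : forall i, cancel (tgw_sigmaV i) (tgw_sigma i);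
  tgw_sigmaC : forall i j r,
    tgw_sigma i (tgw_sigma j r) = tgw_sigma j (tgw_sigma i r);
  tgw_t_neq0 : forall i, tgw_t i != 0;
  tgw_t_central : forall i r, tgw_t i * r = r * tgw_t i
}.

Section TGWAlgebra.
Variables (k : fieldType) (I : choiceType) (D : tgw_datum k I).
Variable mu : I -> I -> k. (* only the values mu i j with i != j are used *)

Local Notation F := (freeRring (tgw_R D) (I + I)%type).
Local Notation c := (freeRring_const (I + I)%type : tgw_R D -> F).
Local Notation X i := (freeRring_var (tgw_R D) (inl i : (I + I)%type) : F).
Local Notation Y i := (freeRring_var (tgw_R D) (inr i : (I + I)%type) : F).

Inductive tgwC_rel : F -> Prop :=
| tgwC_Xr i r : tgwC_rel (X i * c r - c (tgw_sigma D i r) * X i)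
| tgwC_Yr i r : tgwC_rel (Y i * c r - c (tgw_sigmaV i r) * Y i)
| tgwC_YX i : tgwC_rel (Y i * X i - c (tgw_t D i))
| tgwC_XY i : tgwC_rel (X i * Y i - c (tgw_sigma D i (tgw_t D i)))
| tgwC_XYmu i j : i != j -> tgwC_rel (X i * Y j - kcst (mu i j) * (Y j * X i)).

Definition tgwC : kAlgType k := alg_quot tgwC_rel.

Definition tgwC_gen (z : tgw_R D + (I + I)) : tgwC :=
  match z with
  | inl r => alg_pi tgwC_rel (c r)
  | inr (inl i) => alg_pi tgwC_rel (X i)
  | inr (inr i) => alg_pi tgwC_rel (Y i)
  end.

(* ZI is {malg int[I]}, with basis elements << i >>.                          *)
Definition tgw_deg (z : tgw_R D + (I + I)) : {malg int[I]} :=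
  match z with
  | inl _ => 0
  | inr (inl i) => << i >>
  | inr (inr i) => - << i >>
  end.

Definition tgwC_component : {malg int[I]} -> set tgwC :=
  component tgwC_gen tgw_deg.

(* The union of all graded ideals meeting the degree-zero component           *)
(* trivially; the ideal it generates is their sum.                            *)
Definition tgwA_rel (x : tgwC) : Prop :=
  exists J : set tgwC, [/\ graded_ideal tgwC_component J,
    forall y, J y -> tgwC_component 0 y -> y = 0 & J x].

Definition tgwA : kAlgType k := alg_quot tgwA_rel.

Definition tgwA_gen (z : tgw_R D + (I + I)) : tgwA :=
  alg_pi tgwA_rel (tgwC_gen z).

Definition tgwA_X (i : I) : tgwA := tgwA_gen (inr (inl i)).
Definition tgwA_Y (i : I) : tgwA := tgwA_gen (inr (inr i)).

Definition tgwA_component : {malg int[I]} -> set tgwA :=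
  component tgwA_gen tgw_deg.
End TGWAlgebra.

Definition posnat := {n : nat | (0 < n)%N}.

(* None stands for the empty-set value of s and t.                            *)
Record multiquiver (V E : choiceType) := Multiquiver {
  mq_s : E -> option (V * posnat);
  mq_t : E -> option (V * posnat);
  mq_noloop : forall e u m v n,
    mq_s e = Some (u, m) -> mq_t e = Some (v, n) -> u != v;
  mq_locfin : forall v, finite_set
    [set e | (exists n, mq_s e = Some (v, n)) \/
             (exists n, mq_t e = Some (v, n))]%classic
}.

Section Incidence.
Variables (V E : choiceType) (Gam : multiquiver V E).

Definition mult_at (z : option (V * posnat)) (v : V) : int :=
  if z is Some (w, n) then (if w == v then (val n)%:Z else 0) else 0.

(* For each v, by mq_noloop at most one of the two terms is nonzero.          *)
Definition incidence (e : E) (v : V) : int :=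
  mult_at (mq_t Gam e) v - mult_at (mq_s Gam e) v.

Definition cartan (i j : V) : int :=
  if i == j then 2
  else - \sum_(e \in [set e | incidence e i != 0]%classic) `|incidence e j|.
End Incidence.

Section PolynomialAlgebra.
Variables (k : fieldType) (E : choiceType).
Local Notation RE := {malg k[{cmonom E}]}.

Definition polyU (e : E) : RE := << ucm e >>.

Section Eval.
Variables (S : comAlgType k) (f : E -> S).

Definition cmonom_eval (m : {cmonom E}) : S := \prod_(e <- finsupp m) f e ^+ m e.

Lemma cmonom_evalEw (m : {cmonom E}) (d : {fset E}) : (finsupp m `<=` d)%fset ->
  cmonom_eval m = \prod_(e <- d) f e ^+ m e.
Proof.
move=> le; rewrite /cmonom_eval (big_fset_incl _ le) // => e _.
by rewrite -cmE_neq0 negbK => /eqP ->; rewrite expr0.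
Qed.

Lemma cmonom_eval_mmorphism : mmorphism cmonom_eval.
Proof.
split=> [m1 m2|]; last by rewrite /cmonom_eval mdom1 big_seq_fset0.
rewrite {1}/cmonom_eval mdomD.
rewrite (cmonom_evalEw (fsubsetUl _ (finsupp m2))).
rewrite (cmonom_evalEw (fsubsetUr (finsupp m1) _)).
by rewrite -big_split /=; apply: eq_bigr => e _; rewrite cmM exprD.
Qed.

HB.instance Definition _ :=
  isMultiplicative.Build {cmonom E} S cmonom_eval cmonom_eval_mmorphism.

Definition poly_eval : RE -> S := mmap (in_alg S) cmonom_eval.

HB.instance Definition _ := GRing.RMorphism.on poly_eval.

Lemma poly_eval_scalable : scalable poly_eval.
Proof. by move=> c p; rewrite /poly_eval mmapZ /= mulr_algl. Qed.

HB.instance Definition _ :=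
  GRing.isScalable.Build k RE S *:%R poly_eval poly_eval_scalable.

Lemma poly_evalU e : poly_eval (polyU e) = f e.
Proof.
rewrite /poly_eval mmapU /= scale1r mul1r /cmonom_eval mdomU.
by rewrite big_seq_fset1 cmUU expr1.
Qed.
End Eval.

Lemma poly_ind_ext (S : comAlgType k) (f g : {lrmorphism RE -> S}) :
  (forall e, f (polyU e) = g (polyU e)) -> f =1 g.
Proof.
move=> fg p; rewrite [p]monalgE !raddf_sum /=; apply: eq_bigr => m _.
have -> : << p@_m *g m >> = p@_m *: << m >> :> RE.
  by rewrite -mul_malgC malgM_def fgmulUU mulr1 mul1m.
rewrite !linearZ /=; congr (_ *: _).
have [n] := ubnP (mdeg m); elim: n m {p} => // n IH m.
have [->|] := eqVneq m (onecm E); first by rewrite !rmorph1.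
rewrite -mdeg_eq0 => m0 le_mn.
have /fset0Pn [e em] : finsupp m != fset0.
  by apply: contraNneq m0 => m0; rewrite mdegE m0 big_seq_fset0.
have {}em : (0 < m e)%N by rewrite lt0n cmE_neq0.
have mE : m = mmul (ucm e) (divcm m (ucm e)).
  apply/eqP/cmP => i; rewrite cmM divcmE cmU.
  by case: eqVneq em => [<- em|_ _]; rewrite ?subnKC // add0n subn0.
have UM (a b : {cmonom E}) : << mmul a b >> = << a >> * << b >> :> RE.
  by rewrite malgM_def fgmulUU mulr1.
rewrite mE UM !rmorphM /=; congr (_ * _); first exact: fg.
apply: IH; rewrite -ltnS (leq_trans _ le_mn) // ltnS.
by rewrite [in X in (_ <= X)%N]mE mdegM mdegU add1n.
Qed.

Definition shift (a : E -> k) : RE -> RE :=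
  poly_eval (fun e => polyU e + (a e)%:A).

HB.instance Definition _ (a : E -> k) := GRing.LRMorphism.on (shift a).

Lemma shiftU a e : shift a (polyU e) = polyU e + (a e)%:A.
Proof. exact: poly_evalU. Qed.

Lemma shift_comp a b : shift a \o shift b =1 shift (fun e => a e + b e).
Proof.
apply: poly_ind_ext => e /=.
by rewrite !shiftU rmorphD /= shiftU linearZ /= rmorph1 scalerDl addrA.
Qed.

Lemma shift0 : shift (fun=> 0) =1 id.
Proof.
apply: (poly_ind_ext (g := idfun)) => e.
by rewrite /= shiftU scale0r addr0.
Qed.
End PolynomialAlgebra.

Section TGWOfMultiquiver.
Variables (k : fieldType) (V E : choiceType) (Gam : multiquiver V E).
Local Notation RE := {malg k[{cmonom E}]}.

Definition mq_sigma (v : V) : RE -> RE :=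
  shift (fun e => - (incidence Gam e v)%:~R).
HB.instance Definition _ (v : V) := GRing.LRMorphism.on (mq_sigma v).

Definition mq_sigmaV (v : V) : RE -> RE :=
  shift (fun e => (incidence Gam e v)%:~R).

Definition mq_u (e : E) (v : V) : RE :=
  match incidence Gam e v with
  | Posz n => \prod_(0 <= m < n) (polyU k e + m%:R)
  | Negz n => \prod_(1 <= m < n.+2) (polyU k e - m%:R)
  end.

Definition mq_tt (v : V) : RE := \big[*%R/1]_(e \in [set: E]%classic) mq_u e v.

Lemma mq_sigmaK v : cancel (mq_sigma v) (mq_sigmaV v).
Proof.
move=> p; rewrite -[RHS]shift0 [LHS]shift_comp; congr (shift _ p).
by apply/funext => e; rewrite subrr.
Qed.

Lemma mq_sigmaVK v : cancel (mq_sigmaV v) (mq_sigma v).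
Proof.
move=> p; rewrite -[RHS]shift0 [LHS]shift_comp; congr (shift _ p).
by apply/funext => e; rewrite addNr.
Qed.

Lemma mq_sigmaC v w p : mq_sigma v (mq_sigma w p) = mq_sigma w (mq_sigma v p).
Proof.
rewrite [LHS]shift_comp [RHS]shift_comp; congr (shift _ p).
by apply/funext => e; rewrite addrC.
Qed.

Lemma mq_tt_neq0 v : mq_tt v != 0.
Proof.
pose ev : {lrmorphism RE -> {poly k}} := poly_eval (fun _ : E => 'X : {poly k}).
suff : ev (mq_tt v) != 0 by apply: contra_neq => ->; rewrite rmorph0.
rewrite /mq_tt rmorph_prod /=; rewrite prodf_seq_neq0; apply/allP => e _.
have Xn0 c : 'X + c%:P != 0 :> {poly k} by rewrite -size_poly_eq0 size_XaddC.
rewrite /mq_u; case: (incidence _ _ _) => n.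
  rewrite rmorph_prod /=; rewrite prodf_seq_neq0; apply/allP => m _.
  by rewrite rmorphD rmorph_nat /= poly_evalU -polyC_natr Xn0.
rewrite rmorph_prod /=; rewrite prodf_seq_neq0; apply/allP => m _.
by rewrite rmorphB rmorph_nat /= poly_evalU -polyC_natr -polyCN Xn0.
Qed.

Definition mq_datum : tgw_datum k V :=
  @TGWDatum k V RE (fun v => mq_sigma v : {lrmorphism RE -> RE}) mq_sigmaV mq_tt
    mq_sigmaK mq_sigmaVK mq_sigmaC mq_tt_neq0 (fun v r => mulrC _ _).

Definition mqA : kAlgType k := tgwA mq_datum (fun _ _ => 1).
Definition mqA_X (i : V) : mqA := tgwA_X mq_datum (fun _ _ => 1) i.
Definition mqA_Y (i : V) : mqA := tgwA_Y mq_datum (fun _ _ => 1) i.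
Definition mqA_component : {malg int[V]} -> set mqA :=
  @tgwA_component k V mq_datum (fun _ _ => 1).
End TGWOfMultiquiver.

HB.mixin Record isLieAlgebra (k : pzRingType) L of GRing.Lmodule k L := {
  lie : L -> L -> L;
  lieDl : forall x y z, lie (x + y) z = lie x z + lie y z;
  lieDr : forall x y z, lie x (y + z) = lie x y + lie x z;
  lieZl : forall (c : k) x y, lie (c *: x) y = c *: lie x y;
  lieZr : forall (c : k) x y, lie x (c *: y) = c *: lie x y;
  liexx : forall x, lie x x = 0;
  lie_jacobi : forall x y z,
    lie x (lie y z) + lie y (lie z x) + lie z (lie x y) = 0
}.

#[short(type="lieAlgType")]
HB.structure Definition LieAlgebra (k : pzRingType) :=
  {L of isLieAlgebra k L & GRing.Lmodule k L}.

Inductive lie_term (k : fieldType) (X : Type) : Type :=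
| LGen of X
| LZero
| LOpp of lie_term k X
| LAdd of lie_term k X & lie_term k X
| LScale of k & lie_term k X
| LBr of lie_term k X & lie_term k X.

Arguments LZero {k X}.
Arguments LGen {k X} x.

HB.instance Definition _ (k : fieldType) X := gen_eqMixin (lie_term k X).
HB.instance Definition _ (k : fieldType) X := gen_choiceMixin (lie_term k X).

(* The Lie algebra with generators X subject to the relations t = 0, t in rel: *)
(* formal Lie expressions modulo the smallest congruence making them a Lie     *)
(* algebra in which these relations hold.                                      *)
Section PresentedLieAlgebra.
Variables (k : fieldType) (X : Type) (rel : set (lie_term k X)).
Local Notation T := (lie_term k X).

Inductive lie_eq : T -> T -> Prop :=
| lie_eq_rel t : rel t -> lie_eq t LZero
| lie_eq_refl t : lie_eq t t
| lie_eq_sym t u : lie_eq t u -> lie_eq u t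
| lie_eq_trans t u v : lie_eq t u -> lie_eq u v -> lie_eq t v
| lie_eq_opp t t' : lie_eq t t' -> lie_eq (LOpp t) (LOpp t')
| lie_eq_add t t' u u' :
    lie_eq t t' -> lie_eq u u' -> lie_eq (LAdd t u) (LAdd t' u')
| lie_eq_scale c t t' : lie_eq t t' -> lie_eq (LScale c t) (LScale c t')
| lie_eq_br t t' u u' :
    lie_eq t t' -> lie_eq u u' -> lie_eq (LBr t u) (LBr t' u')
| lie_eq_addA t u v : lie_eq (LAdd t (LAdd u v)) (LAdd (LAdd t u) v)
| lie_eq_addC t u : lie_eq (LAdd t u) (LAdd u t)
| lie_eq_add0 t : lie_eq (LAdd LZero t) t
| lie_eq_addN t : lie_eq (LAdd (LOpp t) t) LZero
| lie_eq_scaleA a b t : lie_eq (LScale a (LScale b t)) (LScale (a * b) t)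
| lie_eq_scale1 t : lie_eq (LScale 1 t) t
| lie_eq_scaleDr c t u :
    lie_eq (LScale c (LAdd t u)) (LAdd (LScale c t) (LScale c u))
| lie_eq_scaleDl a b t :
    lie_eq (LScale (a + b) t) (LAdd (LScale a t) (LScale b t))
| lie_eq_brDl t u v : lie_eq (LBr (LAdd t u) v) (LAdd (LBr t v) (LBr u v))
| lie_eq_brDr t u v : lie_eq (LBr t (LAdd u v)) (LAdd (LBr t u) (LBr t v))
| lie_eq_brZl c t u : lie_eq (LBr (LScale c t) u) (LScale c (LBr t u))
| lie_eq_brZr c t u : lie_eq (LBr t (LScale c u)) (LScale c (LBr t u))
| lie_eq_brxx t : lie_eq (LBr t t) LZero
| lie_eq_jacobi t u v :
    lie_eq (LAdd (LAdd (LBr t (LBr u v)) (LBr u (LBr v t))) (LBr v (LBr t u)))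
      LZero.

Definition lie_eqb (t u : T) : bool := `[< lie_eq t u >].

Lemma lie_eqb_refl : reflexive lie_eqb.
Proof. by move=> t; apply/asboolP/lie_eq_refl. Qed.

Lemma lie_eqb_sym : symmetric lie_eqb.
Proof. by move=> t u; apply/asboolP/asboolP => /lie_eq_sym. Qed.

Lemma lie_eqb_trans : transitive lie_eqb.
Proof.
by move=> u t v /asboolP tu /asboolP uv; apply/asboolP/(lie_eq_trans tu).
Qed.

Canonical lie_eqb_equiv :=
  EquivRel lie_eqb lie_eqb_refl lie_eqb_sym lie_eqb_trans.

Definition lie_pres : Type := {eq_quot lie_eqb}.

HB.instance Definition _ := Choice.on lie_pres.

Definition lie_pi (t : T) : lie_pres := \pi_({eq_quot lie_eqb}) t.
Definition lie_repr (x : lie_pres) : T := repr (x : {eq_quot lie_eqb}).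

Lemma lie_piP t u : lie_pi t = lie_pi u <-> lie_eq t u.
Proof.
rewrite /lie_pi; split; first by move/eqmodP/asboolP.
by move=> tu; apply/eqmodP/asboolP.
Qed.

Lemma lie_reprK x : lie_pi (lie_repr x) = x.
Proof. exact: reprK. Qed.

Lemma lie_pi_repr t : lie_eq (lie_repr (lie_pi t)) t.
Proof. by apply/lie_piP; rewrite lie_reprK. Qed.

Lemma lie_presW (P : lie_pres -> Prop) :
  (forall t, P (lie_pi t)) -> forall x, P x.
Proof. by move=> Ppi x; rewrite -(lie_reprK x). Qed.

Definition lp_opp (x : lie_pres) := lie_pi (LOpp (lie_repr x)).
Definition lp_add (x y : lie_pres) := lie_pi (LAdd (lie_repr x) (lie_repr y)).
Definition lp_scale (c : k) (x : lie_pres) := lie_pi (LScale c (lie_repr x)).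
Definition lp_br (x y : lie_pres) := lie_pi (LBr (lie_repr x) (lie_repr y)).

Lemma lp_oppE t : lp_opp (lie_pi t) = lie_pi (LOpp t).
Proof. exact/lie_piP/lie_eq_opp/lie_pi_repr. Qed.

Lemma lp_addE t u : lp_add (lie_pi t) (lie_pi u) = lie_pi (LAdd t u).
Proof. by apply/lie_piP; apply: lie_eq_add; apply: lie_pi_repr. Qed.

Lemma lp_scaleE c t : lp_scale c (lie_pi t) = lie_pi (LScale c t).
Proof. exact/lie_piP/lie_eq_scale/lie_pi_repr. Qed.

Lemma lp_brE t u : lp_br (lie_pi t) (lie_pi u) = lie_pi (LBr t u).
Proof. by apply/lie_piP; apply: lie_eq_br; apply: lie_pi_repr. Qed.

Definition lpE := (lp_oppE, lp_addE, lp_scaleE, lp_brE).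

Lemma lp_addA : associative lp_add.
Proof.
elim/lie_presW => x; elim/lie_presW => y; elim/lie_presW => z.
by rewrite !lpE; apply/lie_piP; constructor.
Qed.

Lemma lp_addC : commutative lp_add.
Proof.
elim/lie_presW => x; elim/lie_presW => y.
by rewrite !lpE; apply/lie_piP; apply: lie_eq_addC.
Qed.

Lemma lp_add0 : left_id (lie_pi LZero) lp_add.
Proof.
by elim/lie_presW => x; rewrite !lpE; apply/lie_piP; apply: lie_eq_add0.
Qed.

Lemma lp_addN : left_inverse (lie_pi LZero) lp_opp lp_add.
Proof.
by elim/lie_presW => x; rewrite !lpE; apply/lie_piP; apply: lie_eq_addN.
Qed.

HB.instance Definition _ := GRing.isZmodule.Build lie_pres
  lp_addA lp_addC lp_add0 lp_addN.

Lemma lp_scaleA (a b : k) x : lp_scale a (lp_scale b x) = lp_scale (a * b) x.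
Proof.
by elim/lie_presW: x => x; rewrite !lpE; apply/lie_piP; apply: lie_eq_scaleA.
Qed.

Lemma lp_scale1 : left_id 1 lp_scale.
Proof.
by elim/lie_presW => x; rewrite !lpE; apply/lie_piP; apply: lie_eq_scale1.
Qed.

Lemma lp_scaleDr : right_distributive lp_scale +%R.
Proof.
move=> c; elim/lie_presW => x; elim/lie_presW => y.
by rewrite /GRing.add /= !lpE; apply/lie_piP; apply: lie_eq_scaleDr.
Qed.

Lemma lp_scaleDl x : {morph lp_scale^~ x : a b / a + b}.
Proof.
move=> a b; elim/lie_presW: x => x.
rewrite !lpE [RHS]lp_addE; apply/lie_piP; exact: lie_eq_scaleDl.
Qed.

HB.instance Definition _ := GRing.Zmodule_isLmodule.Build k lie_pres
  lp_scaleA lp_scale1 lp_scaleDr lp_scaleDl.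

Lemma lp_brDl (x y z : lie_pres) : lp_br (x + y) z = lp_br x z + lp_br y z.
Proof.
elim/lie_presW: x => x; elim/lie_presW: y => y; elim/lie_presW: z => z.
by rewrite /GRing.add /= !lpE; apply/lie_piP; apply: lie_eq_brDl.
Qed.

Lemma lp_brDr (x y z : lie_pres) : lp_br x (y + z) = lp_br x y + lp_br x z.
Proof.
elim/lie_presW: x => x; elim/lie_presW: y => y; elim/lie_presW: z => z.
by rewrite /GRing.add /= !lpE; apply/lie_piP; apply: lie_eq_brDr.
Qed.

Lemma lp_brZl (c : k) (x y : lie_pres) : lp_br (c *: x) y = c *: lp_br x y.
Proof.
elim/lie_presW: x => x; elim/lie_presW: y => y.
by rewrite /GRing.scale /= !lpE; apply/lie_piP; apply: lie_eq_brZl.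
Qed.

Lemma lp_brZr (c : k) (x y : lie_pres) : lp_br x (c *: y) = c *: lp_br x y.
Proof.
elim/lie_presW: x => x; elim/lie_presW: y => y.
by rewrite /GRing.scale /= !lpE; apply/lie_piP; apply: lie_eq_brZr.
Qed.

Lemma lp_brxx (x : lie_pres) : lp_br x x = 0.
Proof.
elim/lie_presW: x => x.
by rewrite !lpE; apply/lie_piP; apply: lie_eq_brxx.
Qed.

Lemma lp_jacobi (x y z : lie_pres) :
  lp_br x (lp_br y z) + lp_br y (lp_br z x) + lp_br z (lp_br x y) = 0.
Proof.
elim/lie_presW: x => x; elim/lie_presW: y => y; elim/lie_presW: z => z.
by rewrite /GRing.add /= !lpE; apply/lie_piP; apply: lie_eq_jacobi.
Qed.

HB.instance Definition _ := isLieAlgebra.Build k lie_pres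
  lp_brDl lp_brDr lp_brZl lp_brZr lp_brxx lp_jacobi.
End PresentedLieAlgebra.

Section Enveloping.
Variables (k : fieldType) (L : lieAlgType k).
Local Notation TL := {malg k[{fmonom L}]}.
Local Notation "[[ x ]]" := (<< fmu x >> : TL).

(* Generators of the kernel of the map from the free algebra on the set L to  *)
(* the universal enveloping algebra of L.                                     *)
Inductive env_rel : TL -> Prop :=
| env_add (x y : L) : env_rel ([[ x + y ]] - ([[ x ]] + [[ y ]]))
| env_scale (c : k) (x : L) : env_rel ([[ c *: x ]] - c *: [[ x ]])
| env_br (x y : L) :
    env_rel ([[ x ]] * [[ y ]] - [[ y ]] * [[ x ]] - [[ lie x y ]]).

Definition env : kAlgType k := alg_quot env_rel.
Definition env_in (x : L) : env := alg_pi env_rel [[ x ]].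
End Enveloping.

Section KacMoodyNilpotent.
Variables (k : fieldType) (V : choiceType) (a : V -> V -> int).

(* (ad x_i)^(1 - a_ij) (x_j), for a generalized Cartan matrix a.              *)
Definition serre_rel (t : lie_term k V) : Prop :=
  exists i j : V, i != j /\
    t = iter `|1 - a i j|%N (LBr (LGen i)) (LGen j).

Definition km_nplus : lieAlgType k := lie_pres serre_rel.
Definition km_e (i : V) : km_nplus := lie_pi serre_rel (LGen i).

(* n^- has the same presentation as n^+, with generators named f_i.           *)
Definition km_nminus : lieAlgType k := lie_pres serre_rel.
Definition km_f (i : V) : km_nminus := lie_pi serre_rel (LGen i).

Definition Uplus_component : {malg int[V]} -> set (env km_nplus) :=
  component (fun i => env_in (km_e i)) (fun i => << i >>).
Definition Uminus_component : {malg int[V]} -> set (env km_nminus) :=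
  component (fun i => env_in (km_f i)) (fun i => - << i >>).
End KacMoodyNilpotent.

Definition graded_hom (k : fieldType) (G : zmodType) (A B : kAlgType k)
    (cA : G -> set A) (cB : G -> set B) (f : {rmorphism A -> B}) : Prop :=
  (forall c : k, f (kcst c) = kcst c) /\ (forall d x, cA d x -> cB d (f x)).

Arguments Uplus_component k {V} a d _ : rename.
Arguments Uminus_component k {V} a d _ : rename.
Arguments mqA_component k {V E} Gam d _ : rename.

(* Main.v *)
Require Import Defs.
From HB Require Import structures.
From mathcomp Require Import all_boot all_order all_algebra.
From mathcomp Require Import finmap.
From mathcomp Require Import boolp classical_sets functions cardinality fsbigop.
From mathcomp Require Import xfinmap monalg.
Import Order.TTheory GRing.Theory Num.Theory.
Set Implicit Arguments.
Unset Strict Implicit.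
Unset Printing Implicit Defensive.
Local Open Scope ring_scope.

(* Sending X_v to a product of powers of x_e and d/dx_e, and u_e to
   (d/dx_e) x_e, represents C on k[u_e | e in E] by polynomials times shifts
   of the u_e. Since C_0 is the image of R, on which this representation is
   faithful, and since every C_d contains an element acting injectively, a
   homogeneous element of C vanishes in the TGW algebra iff it acts by zero.
   For each edge one may choose whether x_e or d/dx_e is a pure shift. Given
   i != j, choose so that X_i is the pure shift s; then X_j is a shift times a
   product q of - a_ij linear forms not fixed by s, so that
   ad(X_i)^m (X_j) has coefficient (s - 1)^m q, which vanishes for
   m = 1 - a_ij. The component of degree n alpha_i + alpha_j is spanned by the
   e_i^l e_j e_i^(n - l), whose images have coefficients s^l q; in
   characteristic zero these are independent for n <= deg q = - a_ij. *)

(** * Universal properties *)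

(** The TGW algebra is a quotient by a sum of ideals with no explicit generators. A relation in it
    therefore needs a suitable graded ideal, and a non-relation needs a representation that kills
    all such ideals; a representation of C that is faithful on constants and injective on letters
    provides both.

    The gauge may depend on (i, j) because the homomorphisms make no reference to it: each Serre
    relation and each injectivity statement brings its own representation. An edge meeting both i
    and j has one of them as source and the other as target, so of X_i and X_j one acts through x_e
    and the other through d/dx_e. Making X_i a pure shift at such an edge puts the whole factor of
    that edge on X_j. At edges missing i the gauge takes the factor away from X_j. What remains is
    one linear form for each unit of |gamma_ej| over the edges with gamma_ei nonzero, hence exactly
    - a_ij forms, and all of them are moved by the shift. The upper bound on n and the exponent 1 -
    a_ij of the Serre relation thus come from the same degree. *)

Section KcstTheory.
Variables (k : fieldType) (A : kAlgType k).

Lemma kcst0 : kcst 0 = 0 :> A.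
Proof. by apply: (addrI (kcst 0)); rewrite -kcstD !addr0. Qed.

Lemma kcstN c : kcst (- c) = - kcst c :> A.
Proof. by apply: (addrI (kcst c)); rewrite -kcstD !subrr kcst0. Qed.

Lemma kcstCA c (x y : A) : x * (kcst c * y) = kcst c * (x * y).
Proof. by rewrite mulrA -kcst_central mulrA. Qed.
End KcstTheory.

Section RmorphismRelations.
Variables (k : fieldType) (A B : kAlgType k) (f : {rmorphism A -> B}).

Lemma rmorph_eqB x y : f x = f y -> f (x - y) = 0.
Proof. by rewrite rmorphB => ->; rewrite subrr. Qed.

Lemma rmorph_eqM x y z : f x * f y = f z -> f (x * y - z) = 0.
Proof. by rewrite -rmorphM; apply: rmorph_eqB. Qed.

Lemma rmorph_eqMM x y z t : f x * f y = f z * f t -> f (x * y - z * t) = 0.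
Proof. by rewrite -!rmorphM; apply: rmorph_eqB. Qed.

Lemma rmorph_eq1MM x y z t :
  f x * f y = f z * f t -> f (x * y - kcst 1 * (z * t)) = 0.
Proof. by rewrite kcst1 mul1r; apply: rmorph_eqMM. Qed.

Lemma rmorph_commutator x y : f (x * y - y * x) = f x * f y - f y * f x.
Proof. by rewrite rmorphB !rmorphM. Qed.
End RmorphismRelations.

Section FreeEval.
Variables (k : fieldType) (X : choiceType) (A : kAlgType k) (f : X -> A).
Local Notation FX := {malg k[{fmonom X}]}.

Definition free_eval (p : FX) : A :=
  \sum_(m <- msupp p) kcst p@_m * \prod_(x <- m) f x.

Lemma free_evalEw (d : {fset {fmonom X}}) p : (msupp p `<=` d)%fset ->
  free_eval p = \sum_(m <- d) kcst p@_m * \prod_(x <- m) f x.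
Proof.
move=> le; rewrite [LHS](big_fset_incl _ le) // => m _ /mcoeff_outdom ->.
by rewrite kcst0 mul0r.
Qed.

Lemma free_eval_monom (c : k) m :
  free_eval << c *g m >> = kcst c * \prod_(x <- m) f x.
Proof. by rewrite (free_evalEw msuppU_le) big_seq_fset1 mcoeffUU. Qed.

Lemma free_evalU x : free_eval << fmu x >> = f x.
Proof. by rewrite free_eval_monom kcst1 mul1r fmU big_seq1. Qed.

Lemma free_evalB : {morph free_eval : p q / p - q}.
Proof.
move=> p q; pose d := (msupp p `|` msupp q)%fset.
rewrite (@free_evalEw d) ?msuppB_le // (@free_evalEw d p) ?fsubsetUl //.
rewrite (@free_evalEw d q) ?fsubsetUr // -sumrB; apply: eq_bigr => m _.
by rewrite mcoeffB kcstD kcstN mulrBl.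
Qed.

HB.instance Definition _ :=
  GRing.isZmodMorphism.Build FX A free_eval free_evalB.

Lemma free_eval_monoid_morphism : monoid_morphism free_eval.
Proof.
split; first by rewrite free_eval_monom kcst1 mul1r fm1 big_nil.
move=> p q; rewrite malgME raddf_sum mulr_suml; apply: eq_bigr => m _.
rewrite raddf_sum mulr_sumr; apply: eq_bigr => n _.
rewrite /= free_eval_monom kcstM fmM big_cat /= -!mulrA; congr (_ * _).
by rewrite kcstCA.
Qed.

HB.instance Definition _ :=
  GRing.isMonoidMorphism.Build FX A free_eval free_eval_monoid_morphism.

Lemma free_eval_kcst c : free_eval (kcst c) = kcst c.
Proof. by rewrite free_eval_monom fm1 big_nil mulr1. Qed.

Lemma free_evalZ c p : free_eval (c *: p) = kcst c * free_eval p.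
Proof. by rewrite -mul_malgC rmorphM /= free_eval_kcst. Qed.
End FreeEval.

Lemma malg_fmonom_prod (k : fieldType) (X : choiceType) (m : {fmonom X}) :
  << m >> = \prod_(x <- m) << fmu x >> :> {malg k[{fmonom X}]}.
Proof.
rewrite -(fmK m); case: m => s /=; elim: s => [|x s IH].
  by rewrite big_nil /= -fmoneE.
rewrite big_cons -IH malgM_def fgmulUU mulr1.
by rewrite /mmul /= fmmulE fmU.
Qed.

Section QuotientMorphism.
Variables (k : fieldType) (A : kAlgType k) (S : set A).

Lemma alg_piB : {morph alg_pi S : x y / x - y}.
Proof. by move=> x y; rewrite -[RHS]/(aq_add _ (aq_opp _)) aq_oppE aq_addE. Qed.

Lemma alg_pi_monoid_morphism : monoid_morphism (alg_pi S).
Proof. by split=> // x y; rewrite [RHS]aq_mulE. Qed.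

HB.instance Definition _ :=
  GRing.isZmodMorphism.Build A (alg_quot S) (alg_pi S) alg_piB.
HB.instance Definition _ :=
  GRing.isMonoidMorphism.Build A (alg_quot S) (alg_pi S) alg_pi_monoid_morphism.

Lemma alg_pi_kcst c : alg_pi S (kcst c) = kcst c. Proof. by []. Qed.

Lemma alg_pi_eq0 x : alg_pi S x = 0 <-> ideal_gen S x.
Proof. by rewrite -[X in _ = X](rmorph0 (alg_pi S)) alg_piP subr0. Qed.

Lemma alg_pi_rel0 x : S x -> alg_pi S x = 0.
Proof. by move=> Sx; apply/alg_pi_eq0/ideal_gen_in. Qed.

Lemma alg_pi_rel x y : S (x - y) -> alg_pi S x = alg_pi S y.
Proof. by move=> Sxy; apply/alg_piP/ideal_gen_in. Qed.

Lemma alg_pi_relM x y z : S (x * y - z) -> alg_pi S x * alg_pi S y = alg_pi S z.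
Proof. by rewrite -rmorphM; apply: alg_pi_rel. Qed.

Lemma alg_pi_relMM x y z t : S (x * y - z * t) ->
  alg_pi S x * alg_pi S y = alg_pi S z * alg_pi S t.
Proof. by rewrite -!rmorphM; apply: alg_pi_rel. Qed.

Lemma alg_pi_rel1MM x y z t : S (x * y - kcst 1 * (z * t)) ->
  alg_pi S x * alg_pi S y = alg_pi S z * alg_pi S t.
Proof. by rewrite kcst1 mul1r; apply: alg_pi_relMM. Qed.

Variables (B : kAlgType k) (f : {rmorphism A -> B}).

Lemma ideal_gen_ker x : (forall x, S x -> f x = 0) -> ideal_gen S x -> f x = 0.
Proof.
move=> fS; elim=> {x} [x /fS|||a x _ fx|x a _ fx] //.
- by rewrite rmorph0.
- by move=> x y _ fx _ fy; rewrite rmorphD /= fx fy addr0.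
- by rewrite rmorphM /= fx mulr0.
- by rewrite rmorphM /= fx mul0r.
Qed.

Lemma alg_quot_lift : (forall x, S x -> f x = 0) ->
  exists g : {rmorphism alg_quot S -> B}, forall x, g (alg_pi S x) = f x.
Proof.
move=> fS; pose g (x : alg_quot S) := f (alg_repr x).
have gE x : g (alg_pi S x) = f x.
  apply/eqP; rewrite -subr_eq0 -rmorphB; apply/eqP/ideal_gen_ker => //.
  exact: alg_pi_repr.
have gB : {morph g : x y / x - y}.
  elim/alg_quotW => x; elim/alg_quotW => y.
  by rewrite -rmorphB /= !gE rmorphB.
have gM : monoid_morphism g.
  split; first by rewrite -(rmorph1 (alg_pi S)) gE rmorph1.
  elim/alg_quotW => x; elim/alg_quotW => y.
  by rewrite -rmorphM /= !gE rmorphM.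
pose ga := GRing.isZmodMorphism.Build _ _ g gB.
pose gm := GRing.isMonoidMorphism.Build _ _ g gM.
pose gr : {rmorphism alg_quot S -> B} := HB.pack g ga gm.
by exists gr.
Qed.
End QuotientMorphism.

(** * The algebra of linear endomorphisms of a vector space *)

Section EndAlgebra.
Variables (k : fieldType) (M : lmodType k).

(** Bundled so that composition gives a [kAlgType], the target of the representations of [tgwC] and
    [tgwA]. *)
Record lend := Lend { lend_fun :> M -> M; lend_linear : linear lend_fun }.

HB.instance Definition _ := gen_eqMixin lend.
HB.instance Definition _ := gen_choiceMixin lend.

Lemma lendP (f g : lend) : f =1 g -> f = g.
Proof.
case: f g => [f fl] [g gl] /= /funext fg; rewrite {}fg in fl *.
by congr Lend; apply: Prop_irrelevance.
Qed.

Fact lend_add_subproof (f g : lend) : linear (fun x => f x + g x).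
Proof. by move=> a x y; rewrite !lend_linear scalerDr addrACA. Qed.
Fact lend_opp_subproof (f : lend) : linear (fun x => - f x).
Proof. by move=> a x y; rewrite lend_linear opprD scalerN. Qed.
Fact lend_zero_subproof : linear (fun _ : M => 0 : M).
Proof. by move=> a x y; rewrite scaler0 addr0. Qed.
Fact lend_one_subproof : linear (fun x : M => x).
Proof. by []. Qed.
Fact lend_mul_subproof (f g : lend) : linear (fun x => f (g x)).
Proof. by move=> a x y; rewrite !lend_linear. Qed.
Fact lend_cst_subproof (c : k) : linear (fun x : M => c *: x).
Proof. by move=> a x y; rewrite scalerDr !scalerA mulrC. Qed.

Definition lend_add f g := Lend (lend_add_subproof f g).
Definition lend_opp f := Lend (lend_opp_subproof f).
Definition lend_zero := Lend lend_zero_subproof.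
Definition lend_one := Lend lend_one_subproof.
Definition lend_mul f g := Lend (lend_mul_subproof f g).
Definition lend_cst c := Lend (lend_cst_subproof c).

Fact lend_addA : associative lend_add.
Proof. by move=> f g h; apply: lendP => x /=; rewrite addrA. Qed.
Fact lend_addC : commutative lend_add.
Proof. by move=> f g; apply: lendP => x /=; rewrite addrC. Qed.
Fact lend_add0 : left_id lend_zero lend_add.
Proof. by move=> f; apply: lendP => x /=; rewrite add0r. Qed.
Fact lend_addN : left_inverse lend_zero lend_opp lend_add.
Proof. by move=> f; apply: lendP => x /=; rewrite addNr. Qed.

HB.instance Definition _ := GRing.isZmodule.Build lend
  lend_addA lend_addC lend_add0 lend_addN.

Lemma lend_funD (f g : lend) x : (f + g) x = f x + g x. Proof. by []. Qed.
Lemma lend_funN (f : lend) x : (- f) x = - f x. Proof. by []. Qed.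
Lemma lendD (f : lend) x y : f (x + y) = f x + f y.
Proof. by rewrite -[x]scale1r lend_linear !scale1r. Qed.
Lemma lendB (f : lend) x y : f (x - y) = f x - f y.
Proof. by rewrite addrC -scaleN1r lend_linear scaleN1r addrC. Qed.
Lemma lend0 (f : lend) : f 0 = 0.
Proof. by have := lendB f 0 0; rewrite !subrr. Qed.
Lemma lendZ (f : lend) c x : f (c *: x) = c *: f x.
Proof. by rewrite -[c *: x]addr0 lend_linear lend0 addr0. Qed.

Fact lend_mulA : associative lend_mul.
Proof. by move=> f g h; apply: lendP. Qed.
Fact lend_mul1l : left_id lend_one lend_mul.
Proof. by move=> f; apply: lendP. Qed.
Fact lend_mul1r : right_id lend_one lend_mul.
Proof. by move=> f; apply: lendP. Qed.
Fact lend_mulDl : left_distributive lend_mul +%R.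
Proof. by move=> f g h; apply: lendP. Qed.
Fact lend_mulDr : right_distributive lend_mul +%R.
Proof. by move=> f g h; apply: lendP => x; apply: lendD. Qed.

HB.instance Definition _ := GRing.Zmodule_isPzRing.Build lend
  lend_mulA lend_mul1l lend_mul1r lend_mulDl lend_mulDr.

Lemma lend_funM (f g : lend) x : (f * g) x = f (g x). Proof. by []. Qed.

Fact lend_cstD c d : lend_cst (c + d) = lend_cst c + lend_cst d.
Proof. by apply: lendP => x /=; rewrite scalerDl. Qed.
Fact lend_cstM c d : lend_cst (c * d) = lend_cst c * lend_cst d.
Proof. by apply: lendP => x /=; rewrite scalerA. Qed.
Fact lend_cst1 : lend_cst 1 = 1.
Proof. by apply: lendP => x /=; rewrite scale1r. Qed.
Fact lend_cst_central c f : lend_cst c * f = f * lend_cst c.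
Proof. by apply: lendP => x; rewrite !lend_funM /= lendZ. Qed.

HB.instance Definition _ := isKAlgebra.Build k lend
  lend_cstD lend_cstM lend_cst1 lend_cst_central.

Lemma lend_kcstE c x : (kcst c : lend) x = c *: x. Proof. by []. Qed.
Lemma lend_sum (I : Type) (r : seq I) (F : I -> lend) x :
  (\sum_(i <- r) F i) x = \sum_(i <- r) F i x.
Proof.
by elim: r => [|i r IH]; rewrite ?big_nil // !big_cons lend_funD IH.
Qed.
End EndAlgebra.

(** * The algebra C and its degree-zero component *)

Section NormalForm.
Variables (k : fieldType) (I : choiceType) (D : tgw_datum k I).
Variables (C : kAlgType k) (cC : tgw_R D -> C) (cL : I + I -> C).
Local Notation R := (tgw_R D).
Local Notation cX i := (cL (inl i)).
Local Notation cY i := (cL (inr i)).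
Hypothesis cCD : forall r s, cC (r + s) = cC r + cC s.
Hypothesis cCM : forall r s, cC (r * s) = cC r * cC s.
Hypothesis cC1 : cC 1 = 1.
Hypothesis cXC : forall i r, cX i * cC r = cC (tgw_sigma D i r) * cX i.
Hypothesis cYC : forall i r, cY i * cC r = cC (tgw_sigmaV i r) * cY i.
Hypothesis cYX : forall i, cY i * cX i = cC (tgw_t D i).
Hypothesis cXY : forall i, cX i * cY i = cC (tgw_sigma D i (tgw_t D i)).
Hypothesis cXYC : forall i j, i != j -> cX i * cY j = cY j * cX i.

Definition cW (w : seq (I + I)) : C := \prod_(z <- w) cL z.
Definition cXs (s : seq I) : C := \prod_(i <- s) cX i.
Definition cYs (s : seq I) : C := \prod_(i <- s) cY i.
Definition wdeg (w : seq (I + I)) : {malg int[I]} :=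
  \sum_(z <- w) tgw_deg (inr z : R + (I + I)).

Lemma cW_C w r : exists r', cW w * cC r = cC r' * cW w.
Proof.
rewrite /cW; elim: w => [|z w [r' IH]].
  by exists r; rewrite big_nil mul1r mulr1.
rewrite big_cons -mulrA IH mulrA; case: z => i.
  by exists (tgw_sigma D i r'); rewrite cXC -mulrA.
by exists (tgw_sigmaV i r'); rewrite cYC -mulrA.
Qed.

Lemma cX_Ys_notin i s : i \notin s -> cX i * cYs s = cYs s * cX i.
Proof.
rewrite /cYs; elim: s => [|j s IH]; first by rewrite big_nil mulr1 mul1r.
rewrite inE negb_or big_cons => /andP[ij /IH is_].
by rewrite mulrA cXYC // -!mulrA is_.
Qed.

Lemma cY_Xs_notin i s : i \notin s -> cY i * cXs s = cXs s * cY i.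
Proof.
rewrite /cXs; elim: s => [|j s IH]; first by rewrite big_nil mulr1 mul1r.
rewrite inE negb_or big_cons => /andP[ij /IH is_].
by rewrite mulrA -cXYC 1?eq_sym // -!mulrA is_.
Qed.

Lemma cX_Ys_in i s : i \in s -> exists r, cX i * cYs s = cC r * cYs (rem i s).
Proof.
rewrite /cYs; elim: s => // j s IH; rewrite inE big_cons /=.
have [<- _|ij /= /IH[r E]] := eqVneq i j.
  by exists (tgw_sigma D i (tgw_t D i)); rewrite mulrA cXY.
exists (tgw_sigmaV j r).
by rewrite mulrA cXYC // -mulrA E mulrA cYC big_cons mulrA.
Qed.

Lemma cY_Xs_in i s : i \in s -> exists r, cY i * cXs s = cC r * cXs (rem i s).
Proof.
rewrite /cXs; elim: s => // j s IH; rewrite inE big_cons /=.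
have [<- _|ij /= /IH[r E]] := eqVneq i j.
  by exists (tgw_t D i); rewrite mulrA cYX.
exists (tgw_sigma D j r).
by rewrite mulrA -cXYC 1?eq_sym // -mulrA E mulrA cXC big_cons mulrA.
Qed.

Lemma cXs_YsC s s' : {in s, forall i, i \notin s'} ->
  cXs s * cYs s' = cYs s' * cXs s.
Proof.
rewrite /cXs; elim: s => [|i s IH] ss'; first by rewrite big_nil mulr1 mul1r.
rewrite big_cons -mulrA IH => [|j js]; last by rewrite ss' // inE js orbT.
by rewrite !mulrA cX_Ys_notin // ss' ?mem_head.
Qed.

Let sum_rem (i : I) s : i \in s ->
  \sum_(v <- s) << v >> =
    << i >> + \sum_(v <- rem i s) << v >> :> {malg int[I]}.
Proof. by move=> /perm_to_rem /(perm_big _) ->; rewrite big_cons. Qed.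

(** Letters are absorbed from the left. A new X_i either cancels against the first Y_i, leaving a
    constant, or passes all the Y's and joins the X's; a new Y_i behaves symmetrically. Keeping the
    two lists disjoint lets the degree determine both of them up to order. *)
Lemma cW_normal w : exists r s s',
  [/\ {in s, forall i, i \notin s'},
      wdeg w = \sum_(v <- s') << v >> - \sum_(v <- s) << v >>
    & cW w = cC r * (cYs s * cXs s')].
Proof.
rewrite /cW /wdeg; elim: w => [|z w [r [s [s' [ss' dw Ww]]]]].
  by exists 1, [::], [::]; rewrite /cYs /cXs !big_nil cC1 !mulr1 subrr.
rewrite !big_cons dw Ww; case: z => i /=.
- rewrite mulrA cXC -mulrA.
  have [iS|iS] := boolP (i \in s).
    have [r' E] := cX_Ys_in iS.
    exists (tgw_sigma D i r * r'), (rem i s), s'; split.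
    + by move=> v /mem_rem /ss'.
    + by rewrite (sum_rem iS) opprD addrCA addNKr.
    + by rewrite (mulrA (cX i)) E cCM -!mulrA.
  exists (tgw_sigma D i r), s, (i :: s'); split.
  + move=> v vs; rewrite inE negb_or ss' // andbT.
    by apply: contraNneq iS => <-.
  + by rewrite big_cons addrA.
  + by rewrite (mulrA (cX i)) cX_Ys_notin // /cXs big_cons !mulrA.
- rewrite mulrA cYC -mulrA.
  have s's : {in s', forall v, v \notin s}.
    by move=> v vs'; apply: contraL vs' => /ss'.
  (* No relation of C exchanges two Y's, so the X's are first moved to the front, where the new Y_i
     meets them. *)
  rewrite -cXs_YsC //.
  have [iS|iS] := boolP (i \in s').
    have [r' E] := cY_Xs_in iS.
    exists (tgw_sigmaV i r * r'), s, (rem i s'); split.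
    + move=> v vs; apply/negP => /mem_rem; apply/negP; exact: ss'.
    + by rewrite (sum_rem iS) !addrA addNr add0r.
    + rewrite (mulrA (cY i)) E cCM -!mulrA cXs_YsC // => v /mem_rem; exact: s's.
  exists (tgw_sigmaV i r), (i :: s), s'; split.
  + by move=> v; rewrite inE => /predU1P[->|/ss'].
  + by rewrite big_cons opprD addrCA.
  + rewrite (mulrA (cY i)) cY_Xs_notin // -mulrA.
    congr (_ * _); rewrite -cXs_YsC; first by rewrite /cYs big_cons.
    move=> v vs'; rewrite inE negb_or s's // andbT.
    by apply: contraNneq iS => <-.
Qed.

Lemma mcoeff_sumU (v : I) s :
  (\sum_(i <- s) << i >> : {malg int[I]})@_v = (count_mem v s)%:Z.
Proof.
rewrite raddf_sum /=; elim: s => [|i s IH]; first by rewrite big_nil.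
by rewrite big_cons IH mcoeffU /= PoszD; case: (i == v).
Qed.

(** In degree zero the two lists of the normal form have the same multiplicities; being disjoint,
    they are empty. *)
Lemma cW_deg0 w : wdeg w = 0 -> exists r, cW w = cC r.
Proof.
have [r [s [s' [ss' dw ->]]]] := cW_normal w; rewrite dw => /eqP.
rewrite subr_eq0 => /eqP E; exists r.
have cnt v : count_mem v s' = count_mem v s.
  by have /(congr1 (mcoeff v)) := E; rewrite !mcoeff_sumU => -[].
have [s0 s'0] : s = [::] /\ s' = [::].
  have memE v : (v \in s) = (v \in s') by rewrite -!has_pred1 !has_count cnt.
  case: s s' ss' memE {E cnt dw} => [|v s] [|v' s'] ss' memE //.
  - by have := memE v'; rewrite mem_head.
  - by have := memE v; rewrite mem_head.
  - by have := ss' v (mem_head _ _); rewrite -memE mem_head.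
by rewrite s0 s'0 /cYs /cXs !big_nil !mulr1.
Qed.

(** The inductive grading mixes constants and letters in any order. Here each term has a single
    constant in front of a single word, the form to which the normal form of words applies. *)
Inductive word_span (d : {malg int[I]}) : C -> Prop :=
| word_span_term r w : wdeg w = d -> word_span d (cC r * cW w)
| word_span_zero : word_span d 0
| word_span_add x y : word_span d x -> word_span d y -> word_span d (x + y).

Lemma word_span_mul d e x y :
  word_span d x -> word_span e y -> word_span (d + e) (x * y).
Proof.
move=> sx sy; elim: sx => {x} [r w dw||x x' _ IHx _ IHx'].
- elim: sy => {y} [r' w' dw'||y y' _ IHy _ IHy'].
  + have [r'' E] := cW_C w r'.
    rewrite mulrA -(mulrA (cC r)) E mulrA -cCM -mulrA /cW -big_cat.
    by apply: word_span_term; rewrite /wdeg big_cat /= -dw -dw'.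
  + by rewrite mulr0; apply: word_span_zero.
  + by rewrite mulrDr; apply: word_span_add.
- by rewrite mul0r; apply: word_span_zero.
- by rewrite mulrDl; apply: word_span_add.
Qed.

Hypothesis cCZ : forall c r, cC (c *: r) = kcst c * cC r.

Lemma word_span_scale d c x : word_span d x -> word_span d (kcst c * x).
Proof.
elim=> {x} [r w dw||x y _ IHx _ IHy].
- by rewrite mulrA -cCZ; apply: word_span_term.
- by rewrite mulr0; apply: word_span_zero.
- by rewrite mulrDr; apply: word_span_add.
Qed.

Lemma word_span_const r : word_span 0 (cC r).
Proof.
rewrite -[cC r]mulr1; have -> : 1 = cW [::] by rewrite /cW big_nil.
by apply: word_span_term; rewrite /wdeg big_nil.
Qed.

Lemma word_span_letter z : word_span (tgw_deg (inr z : R + (I + I))) (cL z).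
Proof.
rewrite -[cL z]mul1r -cC1; have -> : cL z = cW [:: z] by rewrite /cW big_seq1.
by apply: word_span_term; rewrite /wdeg big_seq1.
Qed.

Lemma word_span_deg0 x : word_span 0 x -> exists r, x = cC r.
Proof.
elim=> {x} [r w /cW_deg0[r' ->]||].
- by exists (r * r'); rewrite cCM.
- by exists 0; apply: (addrI (cC 0)); rewrite -cCD !addr0.
- by move=> x y _ [r ->] _ [s ->]; exists (r + s); rewrite cCD.
Qed.
End NormalForm.

Section TGWC.
Variables (k : fieldType) (I : choiceType) (D : tgw_datum k I).
Local Notation mu1 := (fun _ _ : I => 1 : k).
Local Notation C := (tgwC D mu1).
Local Notation R := (tgw_R D).

(* The letter inl i is X_i and inr i is Y_i. *)
Definition cC (r : R) : C := tgwC_gen mu1 (inl r).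
Definition cL (z : I + I) : C := tgwC_gen mu1 (inr z).
Local Notation cX i := (cL (inl i)).
Local Notation cY i := (cL (inr i)).

Lemma cCE r : cC r = alg_pi _ (alg_pi _ (fr_const _ r)). Proof. by []. Qed.

Let free_rel0 (x y : {malg k[{fmonom (R + (I + I))%type}]}) :
  freeRring_rel (x - y) ->
  alg_pi (@tgwC_rel k I D mu1) (alg_pi (@freeRring_rel k R (I + I)%type) x) =
  alg_pi _ (alg_pi _ y).
Proof.
move=> xy; congr alg_pi; apply/eqP; rewrite -subr_eq0 -rmorphB /=.
by apply/eqP/alg_pi_rel0.
Qed.

Lemma cCD r s : cC (r + s) = cC r + cC s.
Proof. by rewrite !cCE -!rmorphD; apply/free_rel0/freeRring_add. Qed.

Lemma cCM r s : cC (r * s) = cC r * cC s.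
Proof. by rewrite !cCE -!rmorphM; apply/free_rel0/freeRring_mul. Qed.

Lemma cC1 : cC 1 = 1.
Proof.
have -> : 1 = alg_pi _ (alg_pi _ 1) :> C by rewrite !rmorph1.
exact/free_rel0/freeRring_one.
Qed.

Lemma cC0 : cC 0 = 0.
Proof. by apply: (addrI (cC 0)); rewrite -cCD !addr0. Qed.

Lemma cCZ c r : cC (c *: r) = kcst c * cC r.
Proof.
have -> : kcst c * cC r = alg_pi _ (alg_pi _ (c *: fr_const _ r)).
  by rewrite -mul_malgC !rmorphM.
exact/free_rel0/freeRring_scale.
Qed.

Lemma cC_alg c : cC c%:A = kcst c.
Proof. by rewrite cCZ cC1 mulr1. Qed.

Lemma cXC i r : cX i * cC r = cC (tgw_sigma D i r) * cX i.
Proof. exact: alg_pi_relMM (tgwC_Xr mu1 i r). Qed.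

Lemma cYC i r : cY i * cC r = cC (tgw_sigmaV i r) * cY i.
Proof. exact: alg_pi_relMM (tgwC_Yr mu1 i r). Qed.

Lemma cYX i : cY i * cX i = cC (tgw_t D i).
Proof. exact: alg_pi_relM (tgwC_YX D mu1 i). Qed.

Lemma cXY i : cX i * cY i = cC (tgw_sigma D i (tgw_t D i)).
Proof. exact: alg_pi_relM (tgwC_XY D mu1 i). Qed.

Lemma cXYC i j : i != j -> cX i * cY j = cY j * cX i.
Proof. by move=> ij; apply: alg_pi_rel1MM (tgwC_XYmu D mu1 ij). Qed.

Lemma tgwC_component0 x : tgwC_component 0 x -> exists r, x = cC r.
Proof.
move=> x0; apply: (word_span_deg0 cCD cCM cC1 cXC cYC cYX cXY cXYC).
elim: x0 => {x} [z||d e x y _ + _|d|d x y _ + _|d c x _].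
- case: z => [r|z]; first exact: word_span_const.
  exact: (word_span_letter cL cC1).
- by rewrite -cC1; apply: word_span_const.
- exact: (word_span_mul cCM cXC cYC).
- exact: word_span_zero.
- exact: word_span_add.
- exact: (word_span_scale cCZ).
Qed.

(** C is the image of a free algebra whose monomials go to products of generators, and these are
    homogeneous. *)
Lemma tgwC_homogeneous_sum (x : C) : exists2 s : seq C, x = \sum_(y <- s) y
  & forall y, y \in s -> exists d, tgwC_component d y.
Proof.
elim/alg_quotW: x => x; elim/alg_quotW: x => p.
exists [seq alg_pi _ (alg_pi _ << p@_m *g m >>) | m <- msupp p].
  by rewrite big_map {1}[p]monalgE !raddf_sum.
move=> y /mapP[m _ ->].
have -> : << p@_m *g m >> = kcst p@_m * \prod_(x <- m) << fmu x >>
    :> {malg k[{fmonom (R + (I + I))%type}]}.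
  by rewrite -malg_fmonom_prod malgM_def fgmulUU mulr1 mul1m.
rewrite !rmorphM !rmorph_prod /=; set P := (X in _ * X).
suff [d dP] : exists d, tgwC_component d P.
  by exists d; apply: graded_by_scale.
rewrite {}/P; case: m => s /=; elim: s => [|z s [d IH]].
  by rewrite big_nil; exists 0; apply: graded_by_one.
rewrite big_cons; exists (tgw_deg z + d); apply: graded_by_mul => //.
have -> : alg_pi _ (alg_pi _ << fmu z >>) = tgwC_gen mu1 z by case: z => [|[]].
exact: graded_by_gen.
Qed.

End TGWC.

Section TGWCLift.
Variables (k : fieldType) (I : choiceType) (D : tgw_datum k I) (B : kAlgType k).
Local Notation mu1 := (fun _ _ : I => 1 : k).
Local Notation R := (tgw_R D).
Variables (h : R -> B) (l : I + I -> B).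
Hypothesis hD : forall r s, h (r + s) = h r + h s.
Hypothesis hZ : forall c r, h (c *: r) = kcst c * h r.
Hypothesis hM : forall r s, h (r * s) = h r * h s.
Hypothesis h1 : h 1 = 1.
Hypothesis lXC : forall i r, l (inl i) * h r = h (tgw_sigma D i r) * l (inl i).
Hypothesis lYC : forall i r, l (inr i) * h r = h (tgw_sigmaV i r) * l (inr i).
Hypothesis lYX : forall i, l (inr i) * l (inl i) = h (tgw_t D i).
Hypothesis lXY : forall i,
  l (inl i) * l (inr i) = h (tgw_sigma D i (tgw_t D i)).
Hypothesis lXYC : forall i j, i != j ->
  l (inl i) * l (inr j) = l (inr j) * l (inl i).

Lemma tgwC_lift : exists phi : {rmorphism tgwC D mu1 -> B},
  [/\ forall c, phi (kcst c) = kcst c, forall r, phi (cC r) = h r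
    & forall z, phi (cL D z) = l z].
Proof.
pose f z := match z with inl r => h r | inr z => l z end.
have [|psi psiE] := @alg_quot_lift _ _ (@freeRring_rel k R (I + I)%type) B
    (free_eval f).
  move=> _ [r s|c r|r s|]; apply: rmorph_eqB.
  - by rewrite rmorphD /= !free_evalU /= hD.
  - by rewrite /= free_evalZ !free_evalU /= hZ.
  - by rewrite rmorphM /= !free_evalU /= hM.
  - by rewrite rmorph1 /= free_evalU /= h1.
have psiC r : psi (freeRring_const _ r) = h r by rewrite psiE /= free_evalU.
have psiL z : psi (freeRring_var _ z) = l z by rewrite psiE /= free_evalU.
have [|phi phiE] := @alg_quot_lift _ _ (@tgwC_rel k I D mu1) B psi.
  move=> _ [i r|i r|i|i|i j ij].
  - by apply: rmorph_eqMM; rewrite !psiL !psiC lXC.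
  - by apply: rmorph_eqMM; rewrite !psiL !psiC lYC.
  - by apply: rmorph_eqM; rewrite !psiL !psiC lYX.
  - by apply: rmorph_eqM; rewrite !psiL !psiC lXY.
  - by apply: rmorph_eq1MM; rewrite !psiL lXYC.
have phiC r : phi (cC r) = h r by rewrite phiE psiC.
exists phi; split=> [c|//|[i|i]]; last 2 first.
- by rewrite phiE psiL.
- by rewrite phiE psiL.
by have := phiC c%:A; rewrite cC_alg hZ h1 mulr1.
Qed.
End TGWCLift.

(** * Faithful representations of C factor faithfully through the TGW algebra *)

Section Representation.
Variables (k : fieldType) (I : choiceType) (D : tgw_datum k I) (M : lmodType k).
Local Notation mu1 := (fun _ _ : I => 1 : k).
Local Notation C := (tgwC D mu1).
Local Notation A := (tgwA D mu1).
Variable phi : {rmorphism C -> lend M}.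
Hypothesis phi_const_inj : forall r, phi (cC r) = 0 -> r = 0.
Hypothesis phi_letter_inj : forall z, injective (phi (cL D z)).

(** Every degree is a sum of degrees of letters X_v and Y_v, and the matching product of letters is
    a composite of injective maps. *)
Lemma component_injective d : exists2 c, tgwC_component d c & injective (phi c).
Proof.
pose K d := exists2 c, tgwC_component d c & injective (phi c).
have K0 : K 0 by exists 1; [apply: graded_by_one | rewrite rmorph1].
have KD d1 d2 : K d1 -> K d2 -> K (d1 + d2).
  move=> [x dx ix] [y dy iy]; exists (x * y); first exact: graded_by_mul.
  by rewrite rmorphM => m n /ix /iy.
have KL z : K (tgw_deg (inr z : tgw_R D + (I + I))).
  by exists (cL D z) => //; apply: (graded_by_gen (tgwC_gen mu1)).
rewrite -/(K d) [d]monalgE; apply: (big_ind K) => // v _.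
case: d@_v => n.
  elim: n => [|n IH]; first by rewrite monalgU0.
  by rewrite intS monalgUD; apply: KD => //; apply: (KL (inl v)).
rewrite NegzE; elim: n => [|n IH].
  by rewrite monalgUN; apply: (KL (inr v)).
rewrite intS opprD monalgUD; apply: KD => //.
by rewrite monalgUN; apply: (KL (inr v)).
Qed.

(** For y homogeneous of degree d in an ideal meeting degree zero trivially, take c of degree -d
    acting injectively: c y lies in the ideal and in degree zero, so c y = 0 and y acts by zero. *)
Lemma tgwA_rel_ker x : tgwA_rel x -> phi x = 0.
Proof.
case=> J [[[_ _ Jl _] Jg] J0 /Jg[s -> sJ]]; rewrite raddf_sum /=.
rewrite big_seq big1 // => y /sJ[Jy [d dy]].
have [c dc ic] := component_injective (- d).
have cy0 : c * y = 0.
  apply: J0; first exact: Jl.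
  by have := graded_by_mul dc dy; rewrite addNr.
apply: lendP => m; apply: ic.
by rewrite -lend_funM -rmorphM cy0 rmorph0 !lend0.
Qed.

Lemma tgwA_lift : exists phiA : {rmorphism A -> lend M},
  forall x, phiA (alg_pi _ x) = phi x.
Proof. exact: alg_quot_lift tgwA_rel_ker. Qed.

(** The sums of homogeneous elements acting by zero form a graded ideal. It meets degree zero
    trivially, since that component consists of constants and [phi] is faithful on them; so it is
    one of the ideals divided out. *)
Lemma tgwA_homogeneous_eq0 d x : tgwC_component d x -> phi x = 0 ->
  alg_pi (@tgwA_rel k I D mu1) x = 0.
Proof.
move=> dx phix; apply: alg_pi_rel0.
pose H (y : C) := phi y = 0 /\ exists d, tgwC_component d y.
pose J (y : C) := exists2 s : seq C, y = \sum_(z <- s) z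
  & forall z, z \in s -> H z.
have J0 : J 0 by exists [::]; rewrite ?big_nil.
have JD y z : J y -> J z -> J (y + z).
  move=> [s -> sH] [t -> tH]; exists (s ++ t); first by rewrite big_cat.
  by move=> w; rewrite mem_cat => /orP[/sH|/tH].
have JH y : H y -> J y.
  by exists [:: y]; [rewrite big_seq1 | move=> z; rewrite inE => /eqP ->].
have Jsum (T : eqType) (s : seq T) F : (forall y, y \in s -> J (F y)) ->
    J (\sum_(y <- s) F y).
  by move=> sJ; rewrite big_seq; apply: (big_ind J).
exists J; split; first split; first split => //.
- move=> a y [s -> sH]; have [t -> th] := tgwC_homogeneous_sum a.
  rewrite mulr_suml; apply: (Jsum) => z /th[d1 dz]; rewrite mulr_sumr.
  apply: (Jsum) => w /sH[w0 [d2 dw]]; apply: JH; split.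
    by rewrite rmorphM /= w0 mulr0.
  by exists (d1 + d2); apply: graded_by_mul.
- move=> y a [s -> sH]; have [t -> th] := tgwC_homogeneous_sum a.
  rewrite mulr_suml; apply: (Jsum) => w /sH[w0 [d2 dw]]; rewrite mulr_sumr.
  apply: (Jsum) => z /th[d1 dz]; apply: JH; split.
    by rewrite rmorphM /= w0 mul0r.
  by exists (d2 + d1); apply: graded_by_mul.
- move=> y [s -> sH]; exists s => // z zs; split; first exact/JH/sH.
  by have [] := sH z zs.
- move=> y [s yE sH] /tgwC_component0[r yr].
  have : phi y = 0 by rewrite yE raddf_sum big_seq big1 // => z /sH[].
  by rewrite yr => /phi_const_inj ->; rewrite cC0.
- by apply: JH; split=> //; exists d.
Qed.
End Representation.

(** * Weighted shift operators on polynomials *)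

Lemma lreg_prod (R : comNzRingType) (T : Type) (s : seq T) (F : T -> R) :
  (forall i, GRing.lreg (F i)) -> GRing.lreg (\prod_(i <- s) F i).
Proof.
move=> Fr; elim: s => [|i s IH]; first by rewrite big_nil; apply: lreg1.
by rewrite big_cons; apply: lregM.
Qed.

Section ShiftOperators.
Variables (k : fieldType) (E : choiceType).
Local Notation RE := {malg k[{cmonom E}]}.
Implicit Types (q r : RE) (a b : E -> k) (e : E) (c : k).

Lemma polyU_coefM e r (m : {cmonom E}) :
  (polyU k e * r)@_(mmul (ucm e) m) = r@_m.
Proof.
have ucmI : injective (mmul (ucm e)).
  move=> n n' /eqP /cmP nn'; apply/eqP/cmP => i.
  by have := nn' i; rewrite !cmM => /addnI.
rewrite malgM_def fgmulUg (raddf_sum (mcoeff _)) [in RHS](monalgE r).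
rewrite (raddf_sum (mcoeff _)); apply: eq_bigr => n _.
by rewrite /= !mcoeffU mul1r (inj_eq ucmI).
Qed.

(** Top exponents of u_e are compared: if m has the largest exponent of u_e in the support of r, the
    coefficient of u_e m in the product equals the nonzero coefficient of m in r. *)
Lemma lreg_linear e c : GRing.lreg (polyU k e + c%:A).
Proof.
suff reg0 r : (polyU k e + c%:A) * r = 0 -> r = 0.
  move=> r s rs; apply/eqP; rewrite -subr_eq0; apply/eqP/reg0.
  by rewrite mulrBr rs subrr.
have [->|r0 E0] := eqVneq r 0 => //.
have [m mr max_m] : exists2 m, m \in msupp r
    & forall n, n \in msupp r -> (n e <= m e)%N.
  have /fset0Pn[m0 m0r] : msupp r != fset0 by rewrite msupp_eq0.
  have [m _ max_m] := @arg_maxnP _ [` m0r]%fset predT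
    (fun m : msupp r => (val m : {cmonom E}) e) isT.
  exists (val m); first exact: valP.
  by move=> n nr; have := max_m [` nr]%fset isT.
have := congr1 (mcoeff (mmul (ucm e) m)) E0.
rewrite mulrDl mcoeffD mcoeff0 [X in X + _](polyU_coefM e r m).
rewrite mulr_algl mcoeffZ.
rewrite (@mcoeff_outdom _ _ r (mmul _ m)) => [|]; last first.
  by apply/negP => /max_m; rewrite cmM cmUU add1n ltnn.
by rewrite mulr0 addr0 => /eqP; rewrite mcoeff_eq0 mr.
Qed.

Fact wshift_subproof q a : linear (fun r => q * shift a r).
Proof. by move=> c r s; rewrite linearP mulrDr -scalerAr. Qed.

Definition wshift q a : lend RE := Lend (wshift_subproof q a).

Lemma wshiftM q a r b :
  wshift q a * wshift r b = wshift (q * shift a r) (fun e => a e + b e).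
Proof.
apply: lendP => s; rewrite lend_funM [RHS]/= -[in RHS](shift_comp a b s).
by rewrite /= rmorphM mulrA.
Qed.

Lemma wshift_const q a r :
  wshift q a * wshift r (fun=> 0) = wshift (shift a r) (fun=> 0) * wshift q a.
Proof.
rewrite !wshiftM shift0 mulrC; congr wshift.
by apply/funext => e; rewrite addr0 add0r.
Qed.

Lemma wshift_inj q a : GRing.lreg q -> injective (wshift q a).
Proof.
move=> qr r s /qr E0.
have aK : cancel (shift a) (shift (fun e => - a e)).
  move=> t; rewrite [LHS]shift_comp -[RHS]shift0; congr (shift _ t).
  by apply/funext => e; rewrite addNr.
by rewrite -(aK r) E0 aK.
Qed.

Lemma shift1 a : shift a 1 = 1 :> RE.
Proof. exact: rmorph1. Qed.

(** A common form for the factors u_ev of either sign, stable under shifts. Commutation relations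
    then amount to cutting one such product at two different places by [risingD]. *)
Definition rising e c n : RE := \prod_(l < n) (polyU k e + (c + l%:R)%:A).

Lemma risingD e c m n :
  rising e c (m + n) = rising e c m * rising e (c + m%:R) n.
Proof.
have -> : rising e (c + m%:R) n =
    \prod_(l < n) (polyU k e + (c + (m + l)%:R)%:A).
  by apply: eq_bigr => l _; rewrite natrD addrA.
by rewrite /rising big_split_ord.
Qed.

Lemma shift_rising a e c n : shift a (rising e c n) = rising e (a e + c) n.
Proof.
rewrite /rising rmorph_prod; apply: eq_bigr => l _ /=.
by rewrite rmorphD /= shiftU linearZ /= rmorph1 -addrA -scalerDl addrA.
Qed.

Lemma lreg_rising e c n : GRing.lreg (rising e c n).
Proof. by apply: lreg_prod => l; apply: lreg_linear. Qed.
End ShiftOperators.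

(** * Representations of the algebra of a multiquiver *)

Lemma fs_prod_finite (R : comNzRingType) (E : choiceType) (A : set E)
    (f : E -> R) :
  finite_set A -> (forall e, ~ A e -> f e = 1) ->
  \big[*%R/1]_(e \in [set: E]%classic) f e = \prod_(e <- fset_set A) f e.
Proof.
move=> finA f1; rewrite -(fsbig_widen A) ?fsbig_finite //.
by move=> e [_ /f1].
Qed.

Section Incidence.
Variables (V E : choiceType) (Gam : multiquiver V E).
Local Notation inc := (incidence Gam).

Lemma incidence_finite v : finite_set [set e | inc e v != 0]%classic.
Proof.
apply: sub_finite_set (mq_locfin Gam v) => e /=; rewrite /incidence /mult_at.
case: (mq_t Gam e) (mq_s Gam e) => [[w n]|] [[u m]|] /=.
- case: (w =P v) => [->|_]; first by right; exists n.
  by case: (u =P v) => [->|_]; [left; exists m|].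
- by case: (w =P v) => [->|_]; [right; exists n|].
- by case: (u =P v) => [->|_]; [left; exists m|].
- by [].

Qed.

Lemma mult_at_ge0 z (v : V) : 0 <= mult_at z v.
Proof. by case: z => [[w n]|] //=; case: ifP. Qed.

Lemma mult_at_eq0 z (i j : V) : i != j -> mult_at z i = 0 \/ mult_at z j = 0.
Proof.
case: z => [[w n]|] /=; last by left.
by case: (w =P i) => [->|_]; auto; move/negbTE ->; right.
Qed.

(** An edge has one source and one target, so an edge meeting both vertices runs from one to the
    other. *)
Lemma incidence_opp e i j : i != j -> inc e i != 0 -> inc e j != 0 ->
  (0 < inc e j) = ~~ (0 < inc e i).
Proof.
move=> ij; rewrite /incidence.
have gt0 z (v : V) : (0 < mult_at z v) = (mult_at z v != 0).
  by rewrite lt_def mult_at_ge0 andbT.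
have [-> | ->] := mult_at_eq0 (mq_t Gam e) ij;
    have [-> | ->] := mult_at_eq0 (mq_s Gam e) ij;
    rewrite ?subrr ?eqxx // ?subr0 ?sub0r ?oppr_eq0 ?oppr_gt0 ?gt0.
- by move=> _ ->; rewrite -leNgt mult_at_ge0.
- by move=> -> _; rewrite ltNge mult_at_ge0.
Qed.

Lemma cartan_absz i j : i != j ->
  `|cartan Gam i j|%N =
    (\sum_(e <- fset_set [set e | inc e i != 0]%classic) `|inc e j|)%N.
Proof.
move=> ij; rewrite /cartan (negbTE ij) abszN fsbig_finite; last first.
  exact: incidence_finite.
have -> : \sum_(e <- fset_set [set e | inc e i != 0]%classic) `|inc e j| =
  (\sum_(e <- fset_set [set e | inc e i != 0]%classic) `|inc e j|)%N%:Z.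
  by rewrite (big_morph Posz PoszD erefl); apply: eq_bigr => e _; rewrite abszE.
by rewrite absz_nat.
Qed.
End Incidence.

Section MultiquiverRep.
Variables (k : fieldType) (V E : choiceType) (Gam : multiquiver V E).
Local Notation RE := {malg k[{cmonom E}]}.
Local Notation inc := (incidence Gam).
Local Notation sig v := (fun e => - (inc e v)%:~R : k).
Local Notation sigV v := (fun e => (inc e v)%:~R : k).

Lemma mq_u_rising e v : mq_u k Gam e v =
  rising e (if 0 < inc e v then 0 else (inc e v)%:~R) `|inc e v|.
Proof.
rewrite /mq_u; case: (inc e v) => n.
  case: n => [|n] /=; first by rewrite big_geq // /rising big_ord0.
  rewrite big_mkord; apply: eq_bigr => l _.
  by rewrite add0r scaler_nat.
(* For incidence -(n + 1) the factors u_e - 1, ..., u_e - (n + 1) are reversed so as to rise from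
   u_e - (n + 1). *)
rewrite /= big_add1 /= big_mkord /rising (reindex_inj rev_ord_inj).
apply: eq_bigr => l _; rewrite NegzE.
suff -> : (- n.+1%:Z)%:~R + (nat_of_ord l)%:R = - (n.+1 - l.+1).+1%:R :> k.
  by rewrite scaleNr scaler_nat.
have ln : (l <= n)%N by rewrite -ltnS ltn_ord.
rewrite subSS -subSn // natrB; last exact: leqW.
by rewrite mulrNz opprB addrC -pmulrn.
Qed.

(* In the Weyl algebra X_v is a product of powers of x_e or of d/dx_e. As
   operators on k[u_e], with u_e = d/dx_e x_e, one of x_e and d/dx_e can be
   taken to be a pure shift of u_e; g e says whether this is x_e. *)
Variable g : E -> bool.

(** Contribution of the edge [e] to the coefficient of X_v. Since X_v Y_v must be sigma_v(t_v), the
    factor of each edge goes entirely to X_v or entirely to Y_v; [rep_xe] and [rep_ye] carry it in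
    complementary cases. *)
Definition rep_xe (e : E) (v : V) : RE :=
  if g e != (0 < inc e v) then mq_sigma Gam v (mq_u k Gam e v) else 1.
Definition rep_ye (e : E) (v : V) : RE :=
  if g e == (0 < inc e v) then mq_u k Gam e v else 1.

Lemma mq_u_inc0 e v : inc e v = 0 -> mq_u k Gam e v = 1.
Proof. by move=> i0; rewrite mq_u_rising i0 /rising big_ord0. Qed.

Lemma rep_xe1 e v : inc e v = 0 -> rep_xe e v = 1.
Proof. by move=> i0; rewrite /rep_xe mq_u_inc0 // rmorph1 if_same. Qed.

Lemma rep_ye1 e v : inc e v = 0 -> rep_ye e v = 1.
Proof. by move=> i0; rewrite /rep_ye mq_u_inc0 // if_same. Qed.

Lemma rep_xe_rising e v : exists c n, rep_xe e v = rising e c n.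
Proof.
rewrite /rep_xe; case: ifP => _; last by exists 0, 0; rewrite /rising big_ord0.
by rewrite mq_u_rising /mq_sigma shift_rising; do 2!eexists.
Qed.

Lemma rep_ye_rising e v : exists c n, rep_ye e v = rising e c n.
Proof.
rewrite /rep_ye; case: ifP => _; last by exists 0, 0; rewrite /rising big_ord0.
by rewrite mq_u_rising; do 2!eexists.
Qed.

Lemma shift_rising0 (a : E -> k) e c n : a e = 0 ->
  shift a (rising e c n) = rising e c n.
Proof. by move=> a0; rewrite shift_rising a0 add0r. Qed.

Lemma rep_xeye e v : rep_xe e v * mq_sigma Gam v (rep_ye e v) =
  mq_sigma Gam v (mq_u k Gam e v).
Proof.
by rewrite /rep_xe /rep_ye; case: eqP => _ /=; rewrite ?rmorph1 ?mul1r ?mulr1.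
Qed.

Lemma rep_yexe e v : rep_ye e v * mq_sigmaV Gam v (rep_xe e v) =
  mq_u k Gam e v.
Proof.
rewrite /rep_xe /rep_ye; case: eqP => _ /=.
  by rewrite /mq_sigmaV rmorph1 mulr1.
by rewrite mq_sigmaK mul1r.
Qed.

(** If [e] misses one of the vertices, one coefficient is 1 and the other is fixed by the shift.
    Otherwise the incidences have opposite signs, so the gauge makes the coefficients of X_i and Y_j
    trivial together or nontrivial together. *)
Lemma rep_xeyeC e i j : i != j ->
  rep_xe e i * shift (sig i) (rep_ye e j) =
  rep_ye e j * shift (sigV j) (rep_xe e i).
Proof.
move=> ij; have [i0|i0] := eqVneq (inc e i) 0.
  rewrite (rep_xe1 i0) shift1 mul1r mulr1; have [c [n ->]] := rep_ye_rising e j.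
  by rewrite shift_rising0 // i0 oppr0.
have [j0|j0] := eqVneq (inc e j) 0.
  rewrite (rep_ye1 j0) shift1 mul1r mulr1; have [c [n ->]] := rep_xe_rising e i.
  by rewrite shift_rising0 // j0.
rewrite /rep_xe /rep_ye (incidence_opp ij i0 j0).
have -> : (g e == ~~ (0 < inc e i)) = (g e != (0 < inc e i)).
  by case: (g e); case: (0 < _).
case: eqP => _ /=; first by rewrite !shift1 !mul1r.
rewrite !mq_u_rising /mq_sigma !shift_rising (incidence_opp ij i0 j0).
have absE (z : int) : `|z|%N%:R = (if 0 < z then z%:~R else - z%:~R) :> k.
  by case: z => [[|n]|n]; rewrite ?oppr0 // NegzE mulrNz opprK.
have ye := absE (inc e j); have xe := absE (inc e i).
rewrite (incidence_opp ij i0 j0) in ye.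
set z := (inc e i)%:~R in xe ye *; set y := (inc e j)%:~R in xe ye *.
(* Both sides are one rising product of length |gamma_ei| + |gamma_ej|, cut at two places. It starts
   at - z + y if gamma_ei > 0 and at 0 otherwise. *)
case: ifP xe ye => _ /= xe ye.
  have E1 : rising e (- z) `|inc e i| =
      rising e (- z + y + `|inc e j|%:R) `|inc e i| :> RE by rewrite ye addrK.
  have E2 : rising e y `|inc e j| =
      rising e (- z + y + `|inc e i|%:R) `|inc e j| :> RE.
    by rewrite xe addrAC addNr add0r.
  rewrite addr0 E1 E2 (addrC y) [LHS]mulrC [RHS]mulrC.
  by rewrite -(risingD e _ `|inc e j|) -(risingD e _ `|inc e i|) addnC.
rewrite addNr !addr0.
have -> : - z = 0 + `|inc e i|%:R by rewrite xe add0r.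
have -> : y = 0 + `|inc e j|%:R by rewrite ye add0r.
by rewrite -(risingD e 0 `|inc e i|) -(risingD e 0 `|inc e j|) addnC.
Qed.

End MultiquiverRep.

Section WshiftAlgebra.
Variables (k : fieldType) (E : choiceType).
Local Notation RE := {malg k[{cmonom E}]}.
Implicit Types (r s : RE) (c : k).

Definition wmul r : lend RE := wshift r (fun=> 0).

Lemma wmulE r s : wmul r s = r * s.
Proof. by rewrite /= shift0. Qed.

Lemma wmulD r s : wmul (r + s) = wmul r + wmul s.
Proof. by apply: lendP => t; rewrite lend_funD !wmulE mulrDl. Qed.

Lemma wmulZ c r : wmul (c *: r) = kcst c * wmul r.
Proof. by apply: lendP => t; rewrite lend_funM lend_kcstE !wmulE -scalerAl. Qed.

Lemma wmulM r s : wmul (r * s) = wmul r * wmul s.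
Proof. by apply: lendP => t; rewrite lend_funM !wmulE mulrA. Qed.

Lemma wmul1 : wmul 1 = 1.
Proof. by apply: lendP => t; rewrite wmulE mul1r. Qed.

Lemma wmul_eq0 r : wmul r = 0 -> r = 0.
Proof. by move=> r0; rewrite -[r]mulr1 -wmulE r0. Qed.
End WshiftAlgebra.

Section VertexOperators.
Variables (k : fieldType) (V E : choiceType) (Gam : multiquiver V E).
Local Notation RE := {malg k[{cmonom E}]}.
Local Notation inc := (incidence Gam).
Local Notation sig v := (fun e => - (inc e v)%:~R : k).
Local Notation sigV v := (fun e => (inc e v)%:~R : k).
Local Notation supp v := [set e | inc e v != 0]%classic.
Local Notation C := (tgwC (mq_datum k Gam) (fun _ _ : V => 1 : k)).
Variable g : E -> bool.

Definition rep_x v : RE :=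
  \big[*%R/1]_(e \in [set: E]%classic) rep_xe k Gam g e v.
Definition rep_y v : RE :=
  \big[*%R/1]_(e \in [set: E]%classic) rep_ye k Gam g e v.

Let supp0 (A : set E) v e : (supp v `<=` A)%classic -> ~ A e -> inc e v = 0.
Proof. by move=> vA Ae; apply: contra_notP Ae => /eqP /vA. Qed.

Lemma rep_x_prod (A : set E) v : finite_set A -> (supp v `<=` A)%classic ->
  rep_x v = \prod_(e <- fset_set A) rep_xe k Gam g e v.
Proof.
by move=> finA vA; apply: fs_prod_finite => // e Ae; apply/rep_xe1/(supp0 vA).
Qed.

Lemma rep_y_prod (A : set E) v : finite_set A -> (supp v `<=` A)%classic ->
  rep_y v = \prod_(e <- fset_set A) rep_ye k Gam g e v.
Proof.
by move=> finA vA; apply: fs_prod_finite => // e Ae; apply/rep_ye1/(supp0 vA).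
Qed.

Lemma mq_tt_prod v :
  mq_tt k Gam v = \prod_(e <- fset_set (supp v)) mq_u k Gam e v.
Proof.
apply: fs_prod_finite => [|e Ae]; first exact: incidence_finite.
exact/mq_u_inc0/(supp0 (@subset_refl _ _)).
Qed.

Lemma rep_xy v :
  rep_x v * shift (sig v) (rep_y v) = mq_sigma Gam v (mq_tt k Gam v).
Proof.
have fv := incidence_finite Gam v; have sv := @subset_refl _ (supp v).
rewrite (rep_x_prod fv sv) (rep_y_prod fv sv) mq_tt_prod.
rewrite !rmorph_prod -big_split.
by apply: eq_bigr => e _; apply: rep_xeye.
Qed.

Lemma rep_yx v : rep_y v * shift (sigV v) (rep_x v) = mq_tt k Gam v.
Proof.
have fv := incidence_finite Gam v; have sv := @subset_refl _ (supp v).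
rewrite (rep_x_prod fv sv) (rep_y_prod fv sv) mq_tt_prod rmorph_prod -big_split.
by apply: eq_bigr => e _; apply: rep_yexe.
Qed.

Lemma rep_xyC i j : i != j ->
  rep_x i * shift (sig i) (rep_y j) = rep_y j * shift (sigV j) (rep_x i).
Proof.
move=> ij; have fij : finite_set (supp i `|` supp j)%classic.
  by rewrite finite_setU; split; apply: incidence_finite.
rewrite (rep_x_prod fij (@subsetUl _ _ _)) (rep_y_prod fij (@subsetUr _ _ _)).
rewrite !rmorph_prod -!big_split.
by apply: eq_bigr => e _; apply: rep_xeyeC.
Qed.

Lemma lreg_rep_x v : GRing.lreg (rep_x v).
Proof.
rewrite (rep_x_prod (incidence_finite Gam v) (@subset_refl _ _)).
apply: lreg_prod => e; have [c [n ->]] := rep_xe_rising k Gam g e v.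
exact: lreg_rising.
Qed.

Lemma lreg_rep_y v : GRing.lreg (rep_y v).
Proof.
rewrite (rep_y_prod (incidence_finite Gam v) (@subset_refl _ _)).
apply: lreg_prod => e; have [c [n ->]] := rep_ye_rising k Gam g e v.
exact: lreg_rising.
Qed.

Definition rep_letter (z : V + V) : lend RE :=
  match z with
  | inl v => wshift (rep_x v) (sig v)
  | inr v => wshift (rep_y v) (sigV v)
  end.

(** Available for every gauge [g]. Injectivity of the letters holds because their coefficients are
    products of linear forms, hence regular. *)
Lemma mq_rep : exists phi : {rmorphism C -> lend RE},
  [/\ forall c, phi (kcst c) = kcst c,
      forall r, phi (cC (D := mq_datum k Gam) r) = 0 -> r = 0,
      forall z, injective (phi (cL (mq_datum k Gam) z))
    & forall z, phi (cL (mq_datum k Gam) z) = rep_letter z].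
Proof.
have [| | | | | | | | |phi [phic phiC phiL]] :=
  @tgwC_lift k V (mq_datum k Gam) (lend RE) (@wmul k E) rep_letter.
- exact: wmulD.
- exact: wmulZ.
- exact: wmulM.
- exact: wmul1.
- by move=> i r; apply: wshift_const.
- by move=> i r; apply: wshift_const.
- move=> i; rewrite wshiftM rep_yx; congr wshift.
  by apply/funext => e; rewrite subrr.
- move=> i; rewrite wshiftM rep_xy; congr wshift.
  by apply/funext => e; rewrite addNr.
- move=> i j ij; rewrite !wshiftM rep_xyC //; congr wshift.
  by apply/funext => e; rewrite addrC.
exists phi; split=> [//|r|z|//]; first by rewrite phiC; apply: wmul_eq0.
rewrite phiL; case: z => v; apply: wshift_inj; first exact: lreg_rep_x.
exact: lreg_rep_y.
Qed.
End VertexOperators.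

Section LinearProduct.
Variables (k : fieldType) (E : choiceType).
Local Notation RE := {malg k[{cmonom E}]}.

Definition linprod (s : seq (E * k)) : RE :=
  \prod_(p <- s) (polyU k p.1 + p.2%:A).

Lemma linprod_cons p s : linprod (p :: s) = (polyU k p.1 + p.2%:A) * linprod s.
Proof. by rewrite /linprod big_cons. Qed.

Lemma linprod_cat s t : linprod (s ++ t) = linprod s * linprod t.
Proof. by rewrite /linprod big_cat. Qed.

Lemma linprod_rising e c n :
  rising e c n = linprod [seq (e, c + l%:R) | l <- iota 0 n].
Proof. by rewrite /rising /linprod big_map -[n in iota 0 n]subn0 big_mkord. Qed.

Lemma prod_rising_linprod (d : seq E) (c : E -> k) (n : E -> nat) :
  exists s, [/\ size s = (\sum_(e <- d) n e)%N, {in s, forall p, p.1 \in d}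
    & \prod_(e <- d) rising e (c e) (n e) = linprod s].
Proof.
elim: d => [|e d [s [sz ds E0]]].
  by exists [::]; rewrite !big_nil /linprod big_nil.
exists ([seq (e, c e + l%:R) | l <- iota 0 (n e)] ++ s).
rewrite !big_cons size_cat size_map size_iota sz linprod_cat E0 linprod_rising.
split=> // p; rewrite mem_cat => /orP[/mapP[l _ ->]|/ds]; first exact: mem_head.
by rewrite inE orbC => ->.
Qed.
End LinearProduct.

(** * The representation adapted to a pair of vertices *)

Section PairRep.
Variables (k : fieldType) (V E : choiceType) (Gam : multiquiver V E).
Hypothesis char0 : [pchar k] =i pred0.
Local Notation RE := {malg k[{cmonom E}]}.
Local Notation inc := (incidence Gam).
Local Notation supp v := [set e | inc e v != 0]%classic.
Local Notation D := (mq_datum k Gam).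
Local Notation C := (tgwC D (fun _ _ : V => 1 : k)).
Variables (i j : V).
Hypothesis ij : i != j.

(* The gauge for which X_i is a pure shift; for edges not meeting i, X_j is. *)
Definition gaugeX (e : E) : bool :=
  if inc e i != 0 then 0 < inc e i else 0 < inc e j.
(** Complementing the gauge exchanges the edges whose factor sits on the X letter with those whose
    factor sits on the Y letter, so now Y_i is the pure shift. *)
Definition gaugeY (e : E) : bool := ~~ gaugeX e.

Let gaugeY_eq e (b : bool) : (gaugeY e == b) = (gaugeX e != b).
Proof. by rewrite /gaugeY; case: gaugeX; case: b. Qed.

Lemma gauge_i e : inc e i != 0 -> gaugeX e = (0 < inc e i).
Proof. by rewrite /gaugeX => ->. Qed.

Lemma gauge_j e : inc e i != 0 -> inc e j != 0 -> gaugeX e != (0 < inc e j).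
Proof.
by move=> i0 j0; rewrite gauge_i // (incidence_opp ij i0 j0); case: (0 < _).
Qed.

Lemma gauge_nj e : inc e i = 0 -> gaugeX e = (0 < inc e j).
Proof. by rewrite /gaugeX => ->; rewrite eqxx. Qed.

Lemma rep_x_i : rep_x k Gam gaugeX i = 1.
Proof.
apply: fsbig1 => e _; have [i0|i0] := eqVneq (inc e i) 0; first exact: rep_xe1.
by rewrite /rep_xe gauge_i // eqxx.
Qed.

Lemma rep_y_i : rep_y k Gam gaugeY i = 1.
Proof.
apply: fsbig1 => e _; have [i0|i0] := eqVneq (inc e i) 0; first exact: rep_ye1.
by rewrite /rep_ye gaugeY_eq gauge_i // eqxx.
Qed.

(** At an edge meeting both [i] and [j] the factor removed from X_i reappears on X_j as |gamma_ej|
    linear forms; the edges missing [i] contribute 1 by the choice of gauge. The count is the sum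
    defining - a_ij. *)
Lemma rep_x_j : exists s, [/\ size s = `|cartan Gam i j|%N,
  {in s, forall p, inc p.1 i != 0} & rep_x k Gam gaugeX j = linprod s].
Proof.
have fi := incidence_finite Gam i.
(* The starting point of sigma_j(u_ej) as a rising product: that of u_ej, moved by - gamma_ej. *)
pose c e : k := - (inc e j)%:~R + (if 0 < inc e j then 0 else (inc e j)%:~R).
have [s [sz ds E0]] := prod_rising_linprod (fset_set (supp i)) c
  (fun e => `|inc e j|%N).
exists s; split; first by rewrite sz cartan_absz.
  by move=> p /ds; rewrite in_fset_set // => /set_mem.
rewrite -E0 /rep_x (fs_prod_finite fi) => [|e /negP].
  apply: eq_big_seq => e; rewrite in_fset_set // => /set_mem i0.
  have [j0|j0] := eqVneq (inc e j) 0.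
    by rewrite rep_xe1 // j0 /rising big_ord0.
  by rewrite /rep_xe (gauge_j i0 j0) mq_u_rising /mq_sigma shift_rising.
by rewrite negbK => /eqP i0; rewrite /rep_xe gauge_nj // eqxx.
Qed.

Lemma rep_y_j : exists s, [/\ size s = `|cartan Gam i j|%N,
  {in s, forall p, inc p.1 i != 0} & rep_y k Gam gaugeY j = linprod s].
Proof.
have fi := incidence_finite Gam i.
pose c e : k := if 0 < inc e j then 0 else (inc e j)%:~R.
have [s [sz ds E0]] := prod_rising_linprod (fset_set (supp i)) c
  (fun e => `|inc e j|%N).
exists s; split; first by rewrite sz cartan_absz.
  by move=> p /ds; rewrite in_fset_set // => /set_mem.
rewrite -E0 /rep_y (fs_prod_finite fi) => [|e /negP].
  apply: eq_big_seq => e; rewrite in_fset_set // => /set_mem i0.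
  have [j0|j0] := eqVneq (inc e j) 0.
    by rewrite rep_ye1 // j0 /rising big_ord0.
  by rewrite /rep_ye gaugeY_eq (gauge_j i0 j0) mq_u_rising.
by rewrite negbK => /eqP i0; rewrite /rep_ye gaugeY_eq gauge_nj // eqxx.
Qed.

Lemma pchar0_intr_eq0 (z : int) : (z%:~R == 0 :> k) = (z == 0).
Proof.
have n0 := (pcharf0P k).1 char0.
by case: z => n; rewrite ?NegzE ?mulrNz ?oppr_eq0 -pmulrn n0.
Qed.

(** The switch between the two homomorphisms: X letters for [false], Y letters for [true]. *)
Definition letter (b : bool) (v : V) : V + V := if b then inr v else inl v.

(** In characteristic zero nonzero incidences stay nonzero in [k], so the shift [a] moves every
    linear form of [q]. *)
Lemma pair_rep b : exists (phi : {rmorphism C -> lend RE}) q a a' s,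
  [/\ [/\ forall c, phi (kcst c) = kcst c,
          forall r, phi (cC (D := D) r) = 0 -> r = 0
        & forall z, injective (phi (cL D z))],
      phi (cL D (letter b i)) = wshift 1 a,
      phi (cL D (letter b j)) = wshift q a',
      q = linprod s
    & size s = `|cartan Gam i j|%N /\ {in s, forall p, a p.1 != 0}].
Proof.
case: b.
- have [phi [phic phiC phiI phiL]] := mq_rep k Gam gaugeY.
  have [s [sz si qs]] := rep_y_j.
  exists phi, (rep_y k Gam gaugeY j), (fun e => (inc e i)%:~R),
    (fun e => (inc e j)%:~R), s; split; rewrite ?phiL //=.
    by rewrite rep_y_i.
  by split=> // p /si; rewrite pchar0_intr_eq0.
- have [phi [phic phiC phiI phiL]] := mq_rep k Gam gaugeX.
  have [s [sz si qs]] := rep_x_j.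
  exists phi, (rep_x k Gam gaugeX j), (fun e => - (inc e i)%:~R),
    (fun e => - (inc e j)%:~R), s; split; rewrite ?phiL //=.
    by rewrite rep_x_i.
  by split=> // p /si; rewrite oppr_eq0 pchar0_intr_eq0.
Qed.
End PairRep.

(** * Differences of products of linear forms *)

Section Difference.
Variables (R : comNzRingType) (f : {rmorphism R -> R}).

Definition diff (r : R) : R := f r - r.

Lemma diffD : {morph diff : r s / r + s}.
Proof. by move=> r s; rewrite /diff rmorphD opprD addrACA. Qed.

Lemma iter_diffD n : {morph iter n diff : r s / r + s}.
Proof. by move=> r s; elim: n => //= n ->; rewrite diffD. Qed.

Lemma iter_diff_const n c r : f c = c ->
  iter n diff (c * f r) = c * f (iter n diff r).
Proof.
move=> fc; elim: n => //= n ->.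
by rewrite /diff rmorphM fc -mulrBr rmorphB.
Qed.

(** By the twisted Leibniz rule diff (l r) = l diff r + c f r, each factor that moves by an
    f-invariant constant raises the order of nilpotency by at most one. *)
Lemma iter_diff_mul n l c r : f l = l + c -> f c = c ->
  iter n diff r = 0 -> iter n.+1 diff (l * r) = 0.
Proof.
move=> fl fc; elim: n r => [|n IH] r.
  by move=> /= ->; rewrite mulr0 /diff rmorph0 subrr.
rewrite iterSr => r0; rewrite iterSr.
have -> : diff (l * r) = l * diff r + c * f r.
  by rewrite /diff rmorphM fl mulrBr mulrDl addrAC.
rewrite iter_diffD IH // add0r iter_diff_const //.
by rewrite iterSr r0 rmorph0 mulr0.
Qed.
End Difference.

(** * Independence of the translates of a polynomial *)

Section PolyShift.
Variable k : fieldType.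
Hypothesis char0 : [pchar k] =i pred0.
Local Notation S := (comp_poly ('X + 1 : {poly k})).

Lemma coef_poly_shift (Q : {poly k}) m :
  (S Q)`_m = \sum_(i < size Q) Q`_i * 'C(i, m)%:R.
Proof.
rewrite comp_polyE coef_sum; apply: eq_bigr => i _.
rewrite coefZ; congr (_ * _).
rewrite exprD1n coef_sum; under eq_bigr do rewrite coefMn coefXn.
have [mi|mi] := leqP m i.
  rewrite (bigD1 (Ordinal (mi : (m < i.+1)%N))) //= eqxx big1 ?addr0 // => l lm.
  by rewrite -val_eqE /= eq_sym in lm; rewrite (negbTE lm) mul0rn.
rewrite bin_small // big1 // => l _; rewrite gtn_eqF ?mul0rn //.
exact: leq_trans (ltn_ord l) mi.
Qed.

Lemma poly_shift_lead (Q : {poly k}) : (S Q)`_(size Q).-1 = lead_coef Q.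
Proof.
rewrite coef_poly_shift lead_coefE; case E0 : (size Q) => [|n] /=.
  by rewrite big_ord0 nth_default // E0.
rewrite big_ord_recr /= binn mulr1 big1 ?add0r // => i _.
by rewrite bin_small ?mulr0.
Qed.

Lemma size_poly_shift (Q : {poly k}) : size (S Q) = size Q.
Proof.
by rewrite size_comp_poly2 // -['X + 1]/('X + 1%:P) size_XaddC.
Qed.

Lemma iter_poly_shift_lead n (Q : {poly k}) :
  (iter n S Q)`_(size Q).-1 = lead_coef Q.
Proof.
have sz m : size (iter m S Q) = size Q.
  by elim: m => //= m; rewrite size_poly_shift.
by elim: n => //= n IH; rewrite -{1}(sz n) poly_shift_lead lead_coefE sz.
Qed.

(** If Q has degree n + 1, the coefficient of degree n in S Q - Q is (n + 1) times the leading
    coefficient of Q, nonzero in characteristic zero. *)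
Lemma poly_shift_diff_size (Q : {poly k}) : ((size Q).-1 <= size (S Q - Q)%R)%N.
Proof.
case E0 : (size Q) => [|[|n]] //=.
rewrite ltnNge; apply/negP => /leq_sizeP /(_ n (leqnn n)) /eqP.
rewrite coefB coef_poly_shift E0 2!big_ord_recr /= big1 => [|i _]; last first.
  by rewrite bin_small ?mulr0.
rewrite add0r binn mulr1 binSn addrAC subrr add0r mulf_eq0.
rewrite ((pcharf0P k).1 char0) orbF.
by rewrite -[n.+1]/(n.+2.-1) -E0 -lead_coefE lead_coef_eq0 -size_poly_eq0 E0.
Qed.

Lemma sum_by_parts (M : lmodType k) (c : nat -> k) (f : nat -> M) n :
  \sum_(l < n) (- \sum_(b < l.+1) c b) *: (f l.+1 - f l) =
  \sum_(l < n.+1) c l *: f l - (\sum_(b < n.+1) c b) *: f n.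
Proof.
elim: n => [|n IH]; first by rewrite big_ord0 !big_ord1 subrr.
rewrite big_ord_recr /= IH [in RHS]big_ord_recr /=.
rewrite [X in _ = _ - X *: _]big_ord_recr /=.
rewrite scalerDl scaleNr scalerBr opprB opprD.
by rewrite -!addrA; congr (_ + _); rewrite addrA addNr add0r addrCA subrr addr0.
Qed.

(** All translates have the same leading coefficient, so the sum of the [c] vanishes. Summation by
    parts then turns the relation into a shorter one between translates of S Q - Q, whose degree is
    lower by at most one; its coefficients are the negated partial sums of [c], which determine
    [c]. *)
Lemma poly_shift_free n (Q : {poly k}) (c : nat -> k) : (n < size Q)%N ->
  \sum_(l < n.+1) c l *: iter l S Q = 0 -> forall l, (l <= n)%N -> c l = 0.
Proof.
elim: n Q c => [|n IH] Q c szQ sum0.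
  move=> l; rewrite leqn0 => /eqP ->; move: sum0; rewrite big_ord1 /= => /eqP.
  by rewrite scaler_eq0 -size_poly_eq0 (gtn_eqF szQ) orbF => /eqP.
have c0 : \sum_(b < n.+2) c b = 0.
  have := congr1 (fun p : {poly k} => p`_(size Q).-1) sum0.
  rewrite coef0 coef_sum; under eq_bigr do rewrite coefZ iter_poly_shift_lead.
  rewrite -mulr_suml => /eqP; rewrite mulf_eq0 lead_coef_eq0 -size_poly_eq0.
  by rewrite (gtn_eqF (leq_trans _ szQ)) // orbF => /eqP.
pose d l := - \sum_(b < l.+1) c b.
have d0 l : (l <= n)%N -> d l = 0.
  apply: (IH (S Q - Q) d).
    apply: leq_trans (poly_shift_diff_size Q).
    by rewrite -ltnS prednK ?(leq_trans _ szQ).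
  transitivity (\sum_(l < n.+1) d l *: (iter l.+1 S Q - iter l S Q)).
    apply: eq_bigr => m _; congr (_ *: _).
    by elim: (m : nat) => //= a ->; rewrite rmorphB.
  by rewrite (sum_by_parts c (fun l => iter l S Q)) sum0 c0 scale0r subrr.
have s0 l : (l <= n.+1)%N -> \sum_(b < l.+1) c b = 0.
  rewrite leq_eqVlt => /predU1P[-> //|/d0 /eqP].
  by rewrite oppr_eq0 => /eqP.
case=> [|l] ln; first by have := s0 0%N isT; rewrite big_ord1.
by have := s0 _ ln; rewrite big_ord_recr /= s0 ?add0r // ltnW.
Qed.
End PolyShift.

Section LinprodShift.
Variables (k : fieldType) (E : choiceType) (a : E -> k).
Local Notation RE := {malg k[{cmonom E}]}.

Lemma shift_linear e c :
  shift a (polyU k e + c%:A) = (polyU k e + c%:A) + (a e)%:A.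
Proof. by rewrite rmorphD /= shiftU linearZ /= shift1 [LHS]addrAC. Qed.

Lemma linprod_diff s : iter (size s).+1 (diff (shift a)) (linprod s) = 0 :> RE.
Proof.
elim: s => [|p s IH]; first by rewrite /linprod big_nil /= /diff rmorph1 subrr.
rewrite linprod_cons; apply: (iter_diff_mul (shift_linear p.1 p.2)) IH.
by rewrite /= linearZ /= shift1.
Qed.

(* The line t |-> (a e * t)_e, along which the shift by a is t |-> t + 1. *)
Definition line_eval : RE -> {poly k} :=
  poly_eval (fun e => a e *: 'X : {poly k}).
HB.instance Definition _ := GRing.LRMorphism.on line_eval.

Lemma line_evalU e : line_eval (polyU k e) = a e *: 'X.
Proof. exact: poly_evalU. Qed.

Lemma line_eval_const c : line_eval c%:A = c%:A.
Proof. by rewrite linearZ rmorph1. Qed.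

Lemma line_eval_shift r :
  line_eval (shift a r) = comp_poly ('X + 1) (line_eval r).
Proof.
apply: (poly_ind_ext (f := line_eval \o shift a)
  (g := comp_poly ('X + 1) \o line_eval)) => e.
rewrite /= shiftU rmorphD /= line_evalU line_eval_const.
by rewrite comp_polyZ comp_polyX scalerDr.
Qed.

Lemma size_line_eval_linprod s : {in s, forall p, a p.1 != 0} ->
  size (line_eval (linprod s)) = (size s).+1.
Proof.
elim: s => [|p s IH] ap.
  by rewrite /linprod big_nil rmorph1 size_poly1.
have ap0 : a p.1 != 0 by rewrite ap ?mem_head.
rewrite linprod_cons rmorphM rmorphD /= line_evalU line_eval_const.
have sz2 : size (a p.1 *: 'X + p.2%:A : {poly k}) = 2%N.
  rewrite -mul_polyC alg_polyC size_MXaddC polyC_eq0 (negbTE ap0) /=.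
  by rewrite size_polyC ap0.
rewrite size_mul -?size_poly_eq0 ?sz2 ?IH // => q qs;
  by rewrite ap // inE qs orbT.
Qed.

(** On the line of direction [a] every linear form has slope [a p.1], which is nonzero, so the
    product restricts to a polynomial of degree exactly [size s] and the one-variable statement
    applies. *)
Lemma linprod_shift_free n s (c : nat -> k) : [pchar k] =i pred0 ->
  {in s, forall p, a p.1 != 0} -> (n <= size s)%N ->
  \sum_(l < n.+1) c l *: iter l (shift a) (linprod s) = 0 ->
  forall l, (l <= n)%N -> c l = 0.
Proof.
move=> char0 ap ns /(congr1 line_eval); rewrite rmorph0 linear_sum /= => E0.
apply: (@poly_shift_free _ char0 n (line_eval (linprod s))).
  by rewrite size_line_eval_linprod.
apply: etrans E0; apply: eq_bigr => l _; rewrite linearZ /=; congr (_ *: _).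
by elim: (l : nat) => //= m ->; rewrite line_eval_shift.
Qed.
End LinprodShift.

(** * Homomorphisms from enveloping algebras of presented Lie algebras *)

Section LieEval.
Variables (k : fieldType) (X : Type) (A : kAlgType k) (Z : X -> A).

Definition comm (x y : A) : A := x * y - y * x.

Lemma commDl (x y z : A) : comm (x + y) z = comm x z + comm y z.
Proof. by rewrite /comm mulrDl mulrDr opprD addrACA. Qed.

Lemma commDr (x y z : A) : comm x (y + z) = comm x y + comm x z.
Proof. by rewrite /comm mulrDl mulrDr opprD addrACA. Qed.

Lemma commZl c (x y : A) : comm (kcst c * x) y = kcst c * comm x y.
Proof. by rewrite /comm kcstCA mulrBr -mulrA. Qed.

Lemma commZr c (x y : A) : comm x (kcst c * y) = kcst c * comm x y.
Proof. by rewrite /comm kcstCA mulrBr -mulrA. Qed.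

Lemma comm_jacobi (x y z : A) :
  comm x (comm y z) + comm y (comm z x) + comm z (comm x y) = 0.
Proof.
(* The letters [a] to [f] stand for the six orderings of x, y, z; each of these products occurs
   twice, with opposite signs. *)
have cancel12 (M : zmodType) (a b c d e f : M) :
    a - b - (c - d) + (c - e - (f - b)) + (f - d - (a - e)) = 0.
  have swap (p q r s : M) : (p - q) + (r - s) = (p - s) + (r - q).
    by rewrite addrACA [- q - s]addrC addrACA.
  apply/eqP; rewrite addr_eq0 !opprB; apply/eqP.
  rewrite [LHS]addrACA (swap a b c e) (swap d c b f) [LHS]addrACA.
  by rewrite -[c - b]opprB addNr addr0.
by rewrite /comm !mulrBr !mulrBl !mulrA cancel12.
Qed.

Fixpoint lie_eval (t : lie_term k X) : A :=
  match t with
  | LGen x => Z x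
  | LZero => 0
  | LOpp t => - lie_eval t
  | LAdd t u => lie_eval t + lie_eval u
  | LScale c t => kcst c * lie_eval t
  | LBr t u => comm (lie_eval t) (lie_eval u)
  end.

Variable rel : set (lie_term k X).
Hypothesis rel0 : forall t, rel t -> lie_eval t = 0.

Lemma lie_eval_eq t u : lie_eq rel t u -> lie_eval t = lie_eval u.
Proof.
elim=> {t u} //=.
- by move=> t u v _ -> _ ->.
- by move=> t u _ ->.
- by move=> t t' u u' _ -> _ ->.
- by move=> c t t' _ ->.
- by move=> t t' u u' _ -> _ ->.
- by move=> t u v; rewrite addrA.
- by move=> t u; rewrite addrC.
- by move=> t; rewrite add0r.
- by move=> t; rewrite addNr.
- by move=> a b t; rewrite kcstM mulrA.
- by move=> t; rewrite kcst1 mul1r.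
- by move=> c t u; rewrite mulrDr.
- by move=> a b t; rewrite kcstD mulrDl.
- by move=> t u v; rewrite commDl.
- by move=> t u v; rewrite commDr.
- by move=> c t u; rewrite commZl.
- by move=> c t u; rewrite commZr.
- by move=> t; rewrite /comm subrr.
- by move=> t u v; rewrite comm_jacobi.
Qed.

Lemma env_lift : exists psi : {rmorphism env (lie_pres rel) -> A},
  (forall c, psi (kcst c) = kcst c) /\
  (forall x, psi (env_in (lie_pi rel (LGen x))) = Z x).
Proof.
pose f (x : lie_pres rel) := lie_eval (lie_repr x).
have fE t : f (lie_pi rel t) = lie_eval t by apply/lie_eval_eq/lie_pi_repr.
have fD x y : f (x + y) = f x + f y.
  elim/lie_presW: x => t; elim/lie_presW: y => u.
  by rewrite -[lie_pi _ t + _]/(lp_add _ _) lp_addE !fE.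
have fZ c x : f (c *: x) = kcst c * f x.
  elim/lie_presW: x => t.
  by rewrite -[c *: _]/(lp_scale _ _) lp_scaleE !fE.
have fB x y : f (lie x y) = comm (f x) (f y).
  elim/lie_presW: x => t; elim/lie_presW: y => u.
  by rewrite -[lie _ _]/(lp_br _ _) lp_brE !fE.
have [|psi psiE] := @alg_quot_lift _ _ (@env_rel k (lie_pres rel)) A
    (free_eval f).
  move=> _ [x y|c x|x y]; apply: rmorph_eqB.
  - by rewrite rmorphD /= !free_evalU fD.
  - by rewrite /= free_evalZ !free_evalU fZ.
  - by rewrite rmorph_commutator /= !free_evalU fB.
exists psi; split=> [c|x]; first by rewrite -alg_pi_kcst psiE /= free_eval_kcst.
by rewrite psiE /= free_evalU fE.
Qed.
End LieEval.

(** * Homogeneous components and words of degree n alpha_i + alpha_j *)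

Section GradedSpan.
Variables (k : fieldType) (A : kAlgType k) (G : zmodType) (J : eqType).
Variables (gen : J -> A) (wt : J -> G).

Lemma component_span d x : component gen wt d x -> exists2 s : seq (k * seq J),
  x = \sum_(p <- s) kcst p.1 * \prod_(v <- p.2) gen v
  & forall p, p \in s -> \sum_(v <- p.2) wt v = d.
Proof.
elim=> {d x} [v||d e x y _ [s -> ds] _ [t -> et]|d|d x y _ [s -> ds] _ [t -> dt]
  |d c x _ [s -> ds]].
- exists [:: (1, [:: v])]; first by rewrite big_seq1 /= big_seq1 kcst1 mul1r.
  by move=> p; rewrite inE => /eqP ->; rewrite big_seq1.
- exists [:: (1, [::])]; first by rewrite big_seq1 /= big_nil kcst1 mul1r.
  by move=> p; rewrite inE => /eqP ->; rewrite big_nil.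
- exists [seq (p.1 * q.1, p.2 ++ q.2) | p <- s, q <- t].
    rewrite big_allpairs_dep mulr_suml; apply: eq_bigr => p _.
    rewrite mulr_sumr; apply: eq_bigr => q _ /=.
    by rewrite kcstM big_cat /= -!mulrA; congr (_ * _); rewrite kcstCA.
  move=> _ /allpairsP[[p q] [/= /ds dp /et eq ->]].
  by rewrite big_cat /= dp eq.
- by exists [::]; rewrite ?big_nil.
- exists (s ++ t); first by rewrite big_cat.
  by move=> p; rewrite mem_cat => /orP[/ds|/dt].
- exists [seq (c * p.1, p.2) | p <- s].
    by rewrite big_map mulr_sumr; apply: eq_bigr => p _; rewrite kcstM mulrA.
  by move=> _ /mapP[p /ds dp ->].
Qed.

Lemma component_opp d x : component gen wt d x -> component gen wt d (- x).
Proof.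
by move=> dx; rewrite -mulN1r -(kcst1 (s := A)) -kcstN; apply: graded_by_scale.
Qed.

Lemma component_sub d x y :
  component gen wt d x -> component gen wt d y -> component gen wt d (x - y).
Proof. by move=> dx dy; apply: graded_by_add => //; apply: component_opp. Qed.

Lemma component_iter_comm d e x y n :
  component gen wt d x -> component gen wt e y ->
  component gen wt (d *+ n + e) (iter n (comm x) y).
Proof.
move=> dx ey; elim: n => [|n IH]; first by rewrite mulr0n add0r.
rewrite mulrS -addrA; apply: component_sub; first exact: graded_by_mul.
by rewrite addrC; apply: graded_by_mul.
Qed.
End GradedSpan.

(** The degree counts occurrences: [j] occurs once and every other letter is [i], so the position of
    [j] determines the word. *)
Lemma word_of_degree (V : choiceType) (i j : V) n (w : seq V) : i != j ->
  \sum_(v <- w) << v >> = << i >> *~ n%:Z + << j >> :> {malg int[V]} ->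
  exists2 a, (a <= n)%N & w = nseq a i ++ j :: nseq (n - a) i.
Proof.
move=> ij E0.
have cnt v : count_mem v w = ((i == v) * n + (j == v))%N.
  have := congr1 (mcoeff v) E0.
  rewrite mcoeff_sumU mcoeffD -pmulrn mcoeffMn !mcoeffU.
  by rewrite -mulrnA !natz -PoszD => -[].
have jw : j \in w by rewrite -has_pred1 has_count cnt (negbTE ij) eqxx.
case/splitPr: jw cnt {E0} => w1 w2 cnt.
have w12 : all (pred1 i) (w1 ++ w2).
  apply/allP => v vw /=; apply: contraT => vi.
  have := cnt v; rewrite (eq_sym i) (negbTE vi) mul0n add0n count_cat /= addnCA.
  move/eqP; rewrite -[X in _ == X]addn0 eqn_add2l -count_cat.
  by rewrite eqn0Ngt -has_count has_pred1 vw.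
move: w12; rewrite all_cat => /andP[/all_pred1P w1E /all_pred1P w2E].
have := cnt i; rewrite eqxx eq_sym (negbTE ij) mul1n addn0 count_cat /=.
rewrite eq_sym (negbTE ij) add0n.
have -> : count_mem i w1 = size w1 by rewrite {1}w1E count_nseq /= eqxx mul1n.
have -> : count_mem i w2 = size w2 by rewrite {1}w2E count_nseq /= eqxx mul1n.
move=> sz; exists (size w1); first by rewrite -sz leq_addr.
by rewrite -w1E -sz addKn -w2E.
Qed.

Lemma rmorph_iter_comm (k : fieldType) (A B : kAlgType k)
    (f : {rmorphism A -> B}) n x y :
  f (iter n (comm x) y) = iter n (comm (f x)) (f y).
Proof. by elim: n => //= n <-; rewrite /comm rmorph_commutator. Qed.

Lemma lie_eval_iter (k : fieldType) (X : Type) (A : kAlgType k) (Z : X -> A)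
    n i j :
  lie_eval Z (iter n (LBr (LGen i)) (LGen j)) = iter n (comm (Z i)) (Z j).
Proof. by elim: n => //= n ->. Qed.

Section WshiftString.
Variables (k : fieldType) (E : choiceType).
Local Notation RE := {malg k[{cmonom E}]}.
Variables (a b : E -> k) (q : RE).
Local Notation P := (wshift 1 a).

Lemma wshift1E r : P r = shift a r.
Proof. exact: mul1r. Qed.

Lemma wshift_at1 : wshift q b 1 = q.
Proof. by rewrite /= shift1 mulr1. Qed.

Lemma wshift0 c : wshift 0 c = 0 :> lend RE.
Proof. by apply: lendP => r; apply: mul0r. Qed.

(** The coefficient of [P] is 1, which shifts fix, so commuting with [P] replaces the coefficient r
    by shift a r - r. Only the coefficient is tracked; the shift part is left existential. *)
Lemma wshift_iter_comm n : exists c,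
  iter n (comm P) (wshift q b) = wshift (iter n (diff (shift a)) q) c.
Proof.
elim: n => [|n [c IH]]; first by exists b.
exists (fun e => a e + c e); rewrite !iterS IH.
set r := iter n _ q; rewrite /comm !wshiftM shift1 mul1r mulr1.
have -> : (fun e => c e + a e) = (fun e => a e + c e).
  by apply/funext => e; rewrite addrC.
by apply: lendP => t; rewrite lend_funD lend_funN -mulrBl.
Qed.

(** The operator [P] fixes the polynomial 1, so evaluating there erases the right-hand power and
    leaves only the translations on the left. *)
Lemma wshift_string l m :
  (P ^+ l * (wshift q b * P ^+ m)) 1 = iter l (shift a) q.
Proof.
have -> : (P ^+ l * (wshift q b * P ^+ m)) 1 =
    (P ^+ l) (wshift q b ((P ^+ m) 1)).
  by [].
have -> : (P ^+ m) 1 = 1.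
  elim: m => [|m IH]; first by rewrite expr0.
  by rewrite exprS lend_funM IH wshift1E shift1.
rewrite wshift_at1; elim: l => [|l IH]; first by rewrite expr0.
by rewrite exprS lend_funM IH wshift1E.
Qed.
End WshiftString.

Section StringSpan.
Variables (k : fieldType) (A : kAlgType k) (V : choiceType) (gen : V -> A).
Variables (wt : V -> {malg int[V]}) (i j : V) (n : nat).
Hypothesis ij : i != j.
Hypothesis wtE : forall w : seq V, \sum_(v <- w) wt v = wt i *~ n%:Z + wt j ->
  \sum_(v <- w) << v >> = << i >> *~ n%:Z + << j >> :> {malg int[V]}.

Definition string (l : nat) : A := gen i ^+ l * (gen j * gen i ^+ (n - l)).

Lemma string_span x : component gen wt (wt i *~ n%:Z + wt j) x ->
  exists c : nat -> k, x = \sum_(l < n.+1) kcst (c l) * string l.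
Proof.
move=> /component_span[s -> ds].
pose K x := exists c : nat -> k, x = \sum_(l < n.+1) kcst (c l) * string l.
rewrite -/(K _) big_seq; apply: (big_ind K).
- by exists (fun=> 0); rewrite big1 // => l _; rewrite kcst0 mul0r.
- move=> _ _ [c ->] [d ->]; exists (fun l => c l + d l); rewrite -big_split.
  by apply: eq_bigr => l _; rewrite /= kcstD mulrDl.
- move=> [c w] /ds /= /wtE /(word_of_degree ij)[l ln ->].
  exists (fun m => if m == l then c else 0).
  rewrite (bigD1 (Ordinal (ln : (l < n.+1)%N))) //= eqxx.
  rewrite [X in _ + X]big1 => [|m ml]; last first.
    by rewrite -val_eqE /= in ml; rewrite (negbTE ml) kcst0 mul0r.
  by rewrite addr0 big_cat big_cons /= !big_nseq -!Monoid.iteropE.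
Qed.
End StringSpan.

Lemma rmorph_string_sum (k : fieldType) (A B : kAlgType k)
    (f : {rmorphism A -> B}) (V : choiceType) (gen : V -> A) i j n
    (c : nat -> k) :
  (forall c, f (kcst c) = kcst c) ->
  f (\sum_(l < n.+1) kcst (c l) * string gen i j n l) =
  \sum_(l < n.+1) kcst (c l) * string (f \o gen) i j n l.
Proof.
move=> fc; rewrite raddf_sum; apply: eq_bigr => l _ /=.
by rewrite !rmorphM !rmorphXn fc.
Qed.

(** * The homomorphisms from the enveloping algebras *)

Section EnvelopingHomomorphism.
Variables (k : fieldType) (V E : choiceType) (Gam : multiquiver V E).
Hypothesis char0 : [pchar k] =i pred0.
Local Notation D := (mq_datum k Gam).
Local Notation mu1 := (fun _ _ : V => 1 : k).
Local Notation n := (km_nplus k (cartan Gam)).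
Local Notation e := (fun v : V => env_in (km_e k (cartan Gam) v)).
Variable b : bool.

Definition mqA_letter (v : V) : mqA k Gam :=
  tgwA_gen mu1 (inr (letter b v) : tgw_R D + (V + V)).
Definition letter_deg (v : V) : {malg int[V]} :=
  tgw_deg (inr (letter b v) : tgw_R D + (V + V)).

Lemma mqA_letterE v : mqA_letter v = alg_pi _ (cL D (letter b v)).
Proof. by []. Qed.

(** Off the diagonal a_ij is at most 0, so the absolute value in the Serre exponent is harmless and
    exceeds |a_ij| by one. *)
Lemma cartan_absz_succ i j : i != j ->
  `|1 - cartan Gam i j|%N = `|cartan Gam i j|.+1.
Proof.
move=> ij; have : 0 <= - cartan Gam i j.
  by rewrite /cartan (negbTE ij) opprK; apply: fsumr_ge0.
have -> : cartan Gam i j = - - cartan Gam i j by rewrite opprK.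
by rewrite opprK abszN; case: (- cartan Gam i j).
Qed.

(** The iterated commutator is homogeneous, so it suffices that it act by zero in the representation
    adapted to (i, j). There its coefficient is the (|a_ij| + 1)-fold difference of a product of
    |a_ij| linear forms. *)
Lemma mqA_serre i j : i != j ->
  iter `|1 - cartan Gam i j|%N (comm (mqA_letter i)) (mqA_letter j) = 0.
Proof.
move=> ij; rewrite cartan_absz_succ // !mqA_letterE -rmorph_iter_comm.
have [phi [q [a [a' [s [[_ phiR phiI] phi_i phi_j qs [sz _]]]]]]] :=
  pair_rep Gam char0 ij b.
have dC v : tgwC_component (letter_deg v) (cL D (letter b v)).
  exact: (graded_by_gen (tgwC_gen mu1)).
apply: (tgwA_homogeneous_eq0 phiR (component_iter_comm _ (dC i) (dC j))).
rewrite rmorph_iter_comm phi_i phi_j.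
have [c ->] := wshift_iter_comm a a' q `|cartan Gam i j|.+1.
by rewrite qs -sz linprod_diff wshift0.
Qed.

Lemma letter_deg_sum i j m (w : seq V) :
  \sum_(v <- w) letter_deg v = letter_deg i *~ m + letter_deg j ->
  \sum_(v <- w) << v >> = << i >> *~ m + << j >> :> {malg int[V]}.
Proof.
rewrite /letter_deg; case: b => //=.
by rewrite sumrN mulNrz -opprD => /oppr_inj.
Qed.

(** Since n^- has the presentation of n^+, one statement covers both signs: [component e letter_deg]
    unfolds to [Uplus_component] for [b = false] and to [Uminus_component] for [b = true]. *)
Lemma enveloping_hom : exists psi : {rmorphism env n -> mqA k Gam},
  [/\ graded_hom (component e letter_deg) (mqA_component k Gam) psi,
      forall v, psi (e v) = mqA_letter v
    & forall i j, i != j -> forall m : int, 0 <= m <= - cartan Gam i j ->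
      set_inj (component e letter_deg (letter_deg i *~ m + letter_deg j)) psi].
Proof.
have [|psi [psic psie]] := @env_lift k V (mqA k Gam) mqA_letter
    (serre_rel (cartan Gam)).
  by move=> _ [i [j [ij ->]]]; rewrite lie_eval_iter mqA_serre.
have psiE v : psi (e v) = mqA_letter v by apply: psie.
exists psi; split=> //.
- split=> // d x.
  elim=> {d x}
    [v||d d' x y _ IHx _ IHy|d|d x y _ IHx _ IHy|d c x _ IHx].
  + rewrite psiE; exact: (graded_by_gen (tgwA_gen mu1)).
  + rewrite rmorph1; exact: graded_by_one.
  + rewrite rmorphM; exact: graded_by_mul.
  + rewrite rmorph0; exact: graded_by_zero.
  + rewrite rmorphD; exact: graded_by_add.
  + rewrite rmorphM psic; exact: graded_by_scale.
- move=> i j ij [m|//] /andP[_ mle] x y xd yd xy.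
  have [phi [q [a [a' [s [[phic phiR phiI] phi_i phi_j qs [sz sa]]]]]]] :=
    pair_rep Gam char0 ij b.
  have [phiA phiAE] := tgwA_lift phiI.
  have [c xyE] := string_span ij (@letter_deg_sum i j m)
    (component_sub (set_mem xd) (set_mem yd)).
  have c0 l : (l <= m)%N -> c l = 0.
    apply: (@linprod_shift_free _ _ a m s c char0 sa).
      rewrite sz -lez_nat -abszN gez0_abs //; exact: le_trans mle.
    have phiAc d : phiA (kcst d) = kcst d by rewrite -alg_pi_kcst phiAE phic.
    (* Evaluated at the polynomial 1, this becomes a linear relation between the translates of [q],
       whose coefficients are those of x - y on the strings. *)
    have : phiA (psi (x - y)) 1 = 0 by rewrite rmorphB xy subrr rmorph0.
    rewrite xyE (rmorph_string_sum _ _ _ _ _ psic).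
    rewrite (rmorph_string_sum _ _ _ _ _ phiAc).
    rewrite lend_sum => E0; apply: etrans E0; apply: eq_bigr => l' _.
    have phi_psi v : (phiA \o (psi \o e)) v = phi (cL D (letter b v)).
      by rewrite /comp psiE mqA_letterE phiAE.
    rewrite lend_funM lend_kcstE /string !phi_psi phi_i phi_j.
    by rewrite wshift_string qs.
  apply/eqP; rewrite -subr_eq0 xyE big1 // => l _.
  by rewrite c0 ?kcst0 ?mul0r // -ltnS.
Qed.
End EnvelopingHomomorphism.

Theorem theorem5p5 (k : closedFieldType) (char0 : [pchar k] =i pred0)
    (V E : choiceType) (Gam : multiquiver V E) :
  (exists psi : {rmorphism env (km_nplus k (cartan Gam)) -> mqA k Gam},
    [/\ graded_hom (Uplus_component k (cartan Gam)) (mqA_component k Gam) psi,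
        forall i : V, psi (env_in (km_e k (cartan Gam) i)) = mqA_X k Gam i
      & forall i j : V, i != j ->
        forall n : int, 0 <= n <= - cartan Gam i j ->
          set_inj (Uplus_component k (cartan Gam) (<< i >> *~ n + << j >>))
            psi])
  /\
  (exists psi : {rmorphism env (km_nminus k (cartan Gam)) -> mqA k Gam},
    [/\ graded_hom (Uminus_component k (cartan Gam)) (mqA_component k Gam) psi,
        forall i : V, psi (env_in (km_f k (cartan Gam) i)) = mqA_Y k Gam i
      & forall i j : V, i != j ->
        forall n : int, 0 <= n <= - cartan Gam i j ->
          set_inj
            (Uminus_component k (cartan Gam) (- (<< i >> *~ n) - << j >>))
            psi]).
Proof.
split; first by have [psi psiP] := enveloping_hom Gam char0 false; exists psi.
have [psi [psig psie psiI]] := enveloping_hom Gam char0 true.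
exists psi; split=> // i j ij n nij.
by rewrite -mulNrz; apply: psiI.
Qed.
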